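(* Let $0<\alpha<1$. (A) If $f\in\mathrm{Diff}^{1,\alpha}_0([0,1])$ and $E_1(f)=\emptyset$, then $$\log\Gamma_n(f)=O(n^{1-\alpha}),\qquad n\to\infty.$$ (B) There exists $f_\alpha\in\mathrm{Diff}^{1,\alpha}_0([0,1])$ such that $E_1(f_\alpha)=\emptyset$ and $$\lim_{n\to\infty}\frac{\log\log\Gamma_n(f_\alpha)}{\log n}=1-\alpha.$$
   Context: $\mathrm{Diff}^{1}_0([0,1])$ is the group of all $C^1$-smooth diffeomorphisms of $[0,1]$ onto itself fixing the endpoints $0$ and $1$. $\mathrm{Diff}^{1,\alpha}_0([0,1])$ is the set of those $f\in\mathrm{Diff}^{1}_0([0,1])$ whose derivative is Lipschitz of order $\alpha$: there is a constant $c(f)$ with $|f'(x)-f'(y)|\le c(f)|x-y|^\alpha$ for all $x,y\in[0,1]$. With $f^n$ the $n$-th iterate of $f$ and $f^{-n}$ the $n$-th iterate of $f^{-1}$, the growth sequence of $f$ is $$\Gamma_n(f)=\max\bigl(\max_{x\in[0,1]}|(f^n)'(x)|,\ \max_{x\in[0,1]}|(f^{-n})'(x)|\bigr),\qquad n\ge1.$$ $E_1(f)=\{x\in[0,1]: f(x)=x,\ f'(x)\ne1\}$. *)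

(* Defs.v *)
From Stdlib Require Import Reals ClassicalEpsilon.
Local Open Scope R_scope.

(* A self-map of [0,1] is represented by a function R -> R of which only the
   values on [0,1] matter: every notion below is insensitive to the values
   outside [0,1], and derivatives at 0 and 1 are one-sided. *)
Definition unit_itv (x : R) : Prop := 0 <= x <= 1.

Definition is_deriv (f : R -> R) (x l : R) : Prop :=
  limit1_in (fun y => (f y - f x) / (y - x)) (D_x unit_itv x) l x.

(* Total version of the derivative in [0,1]; arbitrary where f is not
   differentiable. *)
Definition deriv (f : R -> R) (x : R) : R :=
  epsilon (inhabits 0) (is_deriv f x).

Definition C1_itv (f : R -> R) : Prop :=
  forall x, unit_itv x ->
    D_in f (deriv f) unit_itv x /\ continue_in (deriv f) unit_itv x.

Definition bij_itv (f : R -> R) : Prop :=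
  (forall x, unit_itv x -> unit_itv (f x)) /\
  (forall x y, unit_itv x -> unit_itv y -> f x = f y -> x = y) /\
  (forall y, unit_itv y -> exists x, unit_itv x /\ f x = y).

(* The inverse of a bijection of [0,1]; arbitrary otherwise. *)
Definition inv_itv (f : R -> R) (y : R) : R :=
  epsilon (inhabits 0) (fun x => unit_itv x /\ f x = y).

Definition Diff1 (f : R -> R) : Prop :=
  bij_itv f /\ C1_itv f /\ C1_itv (inv_itv f) /\ f 0 = 0 /\ f 1 = 1.

(* The diagonal x = y, where the bound reads 0 <= 0, is left out because
   Rpower 0 alpha is 1 in the library. *)
Definition Diff1_Lip (alpha : R) (f : R -> R) : Prop :=
  Diff1 f /\
  exists c : R, forall x y, unit_itv x -> unit_itv y -> x <> y ->
    Rabs (deriv f x - deriv f y) <= c * Rpower (Rabs (x - y)) alpha.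

Definition is_max_itv (g : R -> R) (m : R) : Prop :=
  (exists x, unit_itv x /\ g x = m) /\ (forall x, unit_itv x -> g x <= m).

(* Arbitrary if g attains no maximum on [0,1]. *)
Definition max_itv (g : R -> R) : R := epsilon (inhabits 0) (is_max_itv g).

Definition Gamma (f : R -> R) (n : nat) : R :=
  Rmax (max_itv (fun x => Rabs (deriv (Nat.iter n f) x)))
       (max_itv (fun x => Rabs (deriv (Nat.iter n (inv_itv f)) x))).

Definition E1_itv (f : R -> R) (x : R) : Prop :=
  unit_itv x /\ f x = x /\ deriv f x <> 1.

(* Main.v *)
Require Import Defs.
From Stdlib Require Import Reals Lra Lia Psatz ClassicalEpsilon.
Local Open Scope R_scope.

(* (A) Let [x_k] be an orbit of [f] and [d_k = |x_{k+1} - x_k|]. By the mean value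
   theorem [d_{k+1} / d_k] is a value of [f'] within [d_k] of [x_k], so
   [ln f'(x_k) = ln d_{k+1} - ln d_k + O(d_k^alpha)]. As the [d_k] sum to at most 1,
   the errors up to time [n] add up to [O(n^(1 - alpha))]. The telescoping part
   [ln d_n - ln d_0] is only [O(ln n)]: since [f'] is 1 at the zeros of [f - id], a
   Glaeser inequality [|f' - 1| <= K |f - id|^beta], [beta = alpha / (1 + alpha)],
   shows that [d_k^(- beta)] changes by a bounded amount at each step.

   (B) Add to the identity disjoint bumps indexed by [q], each on an interval of
   length [2^-(q+1) = N^(-o(1))], [N = 2^(q^2)], and carrying an orbit with [N] equal
   steps of length [delta = N^(-1-o(1))]. An oscillation of period [delta] leaves this orbit in
   place and raises [f'] by about [delta^alpha] along it, which is what the Hölder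
   condition allows; hence [ln Gamma_n] is at least of order [n delta^alpha] for
   [n <= N]. *)

(** * Calculus on the unit interval *)

(** The projection onto [[a, b]]. Composing with it turns a function that matters only on [[0,1]]
    into one on the line, to which two-sided continuity results apply. *)
Definition clip (a b x : R) : R := Rmax a (Rmin b x).

Lemma clip_bounds a b x : a <= b -> a <= clip a b x <= b.
Proof.
unfold clip, Rmax, Rmin; intros.
destruct (Rle_dec b x), (Rle_dec a _); lra.
Qed.

Lemma clip_id a b x : a <= x <= b -> clip a b x = x.
Proof.
unfold clip, Rmax, Rmin; intros.
destruct (Rle_dec b x), (Rle_dec a _); lra.
Qed.

Lemma clip_left a b x : a <= b -> x <= a -> clip a b x = a.
Proof.
unfold clip, Rmax, Rmin; intros.
destruct (Rle_dec b x), (Rle_dec a _); lra.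
Qed.

Lemma clip_right a b x : a <= b -> b <= x -> clip a b x = b.
Proof.
unfold clip, Rmax, Rmin; intros.
destruct (Rle_dec b x), (Rle_dec a _); lra.
Qed.

Lemma clip_lip a b x y : Rabs (clip a b x - clip a b y) <= Rabs (x - y).
Proof.
unfold clip, Rmin; destruct (Rle_dec b x), (Rle_dec b y); unfold Rmax, Rabs;
repeat match goal with
| |- context [Rle_dec ?u ?v] => destruct (Rle_dec u v)
| |- context [Rcase_abs ?u] => destruct (Rcase_abs u)
end; lra.
Qed.

Lemma clip_unit x : unit_itv (clip 0 1 x).
Proof. apply clip_bounds; lra. Qed.

Lemma continuity_clip a b : continuity (clip a b).
Proof.
intros x e e_gt0; exists e; split; [exact e_gt0|]; intros y [_ xy]; simpl in *.
unfold Rdist in *; eapply Rle_lt_trans; [apply clip_lip | exact xy].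
Qed.

Lemma unit_itv_adherent x : unit_itv x -> adhDa (D_x unit_itv x) x.
Proof.
intros x01 e e_gt0; unfold D_x, unit_itv, Rdist in *.
assert (min_gt0 : 0 < Rmin (e / 2) (1 / 2)) by (apply Rmin_glb_lt; lra).
generalize (Rmin_l (e / 2) (1 / 2)) (Rmin_r (e / 2) (1 / 2)).
set (d := Rmin _ _) in *; intros.
destruct (Rle_dec x (1 / 2)).
- exists (x + d); replace (x + d - x) with d by lra.
  rewrite Rabs_pos_eq by lra; lra.
- exists (x - d); replace (x - d - x) with (- d) by lra.
  rewrite Rabs_Ropp, Rabs_pos_eq by lra; lra.
Qed.

(** Every point of [[0,1]], endpoints included, is a limit of other points of [[0,1]], so the limit
    is unique and the chosen derivative must agree with any exhibited one. *)
Lemma deriv_eq f x l : unit_itv x -> is_deriv f x l -> deriv f x = l.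
Proof.
intros x01 fxl; apply (single_limit _ _ _ _ _ (unit_itv_adherent x x01)) with (2 := fxl).
unfold deriv; apply epsilon_spec; now exists l.
Qed.

Lemma is_deriv_ext f g x l : unit_itv x -> (forall y, unit_itv y -> f y = g y) ->
  is_deriv f x l -> is_deriv g x l.
Proof.
intros x01 fg fxl e e_gt0; destruct (fxl e e_gt0) as [d [d_gt0 Hd]].
exists d; split; [exact d_gt0|]; intros y Hy; simpl in *.
rewrite <- !fg by (try exact x01; apply Hy); now apply Hd.
Qed.

Lemma is_deriv_global f x l : derivable_pt_lim f x l -> is_deriv f x l.
Proof.
intros fxl e e_gt0; destruct (fxl e e_gt0) as [d Hd].
exists d; split; [apply cond_pos|]; intros y [[y01 xy] Hy]; simpl in *.
unfold Rdist in *; specialize (Hd (y - x)).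
replace (x + (y - x)) with y in Hd by ring; apply Hd; [lra | exact Hy].
Qed.

Lemma is_deriv_comp f g x k l : unit_itv x -> (forall y, unit_itv y -> unit_itv (f y)) ->
  is_deriv f x k -> is_deriv g (f x) l -> is_deriv (fun y => g (f y)) x (k * l).
Proof.
intros x01 f01 fx gfx.
intros e e_gt0.
destruct (Dcomp unit_itv unit_itv (fun _ => k) (fun _ => l) f g x fx gfx e e_gt0)
  as [d [d_gt0 Hd]].
exists d; split; [exact d_gt0|]; intros y [[y01 xy] Hy]; apply Hd.
split; [split; [split; [exact y01 | exact (f01 y y01)] | exact xy] | exact Hy].
Qed.

Lemma continue_in_clip h : (forall x, unit_itv x -> continue_in h unit_itv x) ->
  continuity (fun x => h (clip 0 1 x)).
Proof.
intros h_cont x e e_gt0.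
destruct (h_cont _ (clip_unit x) e e_gt0) as [d [d_gt0 Hd]].
exists d; split; [exact d_gt0|]; intros y [_ xy]; simpl in *; unfold Rdist in *.
destruct (Req_dec (clip 0 1 x) (clip 0 1 y)) as [-> | neq].
- rewrite Rminus_diag, Rabs_R0; exact e_gt0.
- apply Hd; repeat split; [apply clip_unit | apply clip_unit | exact neq |].
  eapply Rle_lt_trans; [apply clip_lip | exact xy].
Qed.

Lemma continuity_pt_continue_in h x : continuity_pt h x -> continue_in h unit_itv x.
Proof.
intros hx e e_gt0; destruct (hx e e_gt0) as [d [d_gt0 Hd]].
exists d; split; [exact d_gt0|]; intros y [[_ xy] Hy]; apply Hd; repeat split; auto.
Qed.

Lemma continuity_eq f g : (forall x, f x = g x) -> continuity f -> continuity g.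
Proof.
intros fg f_cont x e e_gt0; destruct (f_cont x e e_gt0) as [d [d_gt0 Hd]].
exists d; split; [exact d_gt0|]; intros y Hy; rewrite <- !fg; now apply Hd.
Qed.

(** By compactness the maximum is attained, so the choice in [max_itv] is meaningful. *)
Lemma max_itv_spec h : continuity (fun x => h (clip 0 1 x)) -> is_max_itv h (max_itv h).
Proof.
intros h_cont; unfold max_itv; apply epsilon_spec.
destruct (continuity_ab_maj (fun x => h (clip 0 1 x)) 0 1) as [x [Hx x01]];
  [lra | intros; apply h_cont |].
exists (h x); split; [now exists x|]; intros y y01.
specialize (Hx y y01); rewrite !clip_id in Hx; auto.
Qed.

(** * Iterates *)

(* With [g] the derivative of [f], this is the chain rule product for the
   derivative of the [n]-th iterate of [f]. *)
Fixpoint orbit_prod (g f : R -> R) (n : nat) (x : R) : R :=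
  match n with
  | O => 1
  | S n => orbit_prod g f n x * g (Nat.iter n f x)
  end.

Section UnitMap.

Variables f g : R -> R.
Hypothesis f_unit : forall x, unit_itv x -> unit_itv (f x).

Lemma iter_unit n x : unit_itv x -> unit_itv (Nat.iter n f x).
Proof. intros x01; induction n; simpl; auto. Qed.

Hypothesis f_deriv : forall x, unit_itv x -> is_deriv f x (g x).

Lemma is_deriv_iter n x : unit_itv x -> is_deriv (Nat.iter n f) x (orbit_prod g f n x).
Proof.
intros x01; induction n as [|n IHn]; simpl.
- apply is_deriv_global, derivable_pt_lim_id.
- apply (is_deriv_comp (Nat.iter n f) f);
    [exact x01 | intros y y01; now apply iter_unit | exact IHn | now apply f_deriv, iter_unit].
Qed.

Hypothesis g_cont : forall x, unit_itv x -> continue_in g unit_itv x.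

Lemma continuity_iter_clip n : continuity (fun x => Nat.iter n f (clip 0 1 x)).
Proof.
induction n as [|n IHn]; simpl; [apply continuity_clip|].
apply (continuity_eq (fun x => f (clip 0 1 (Nat.iter n f (clip 0 1 x))))).
- intros x; rewrite clip_id; [reflexivity | apply iter_unit, clip_unit].
- apply (continuity_comp _ (fun y => f (clip 0 1 y)) IHn), continue_in_clip.
  intros x x01; apply (cont_deriv _ (fun _ => g x)), f_deriv, x01.
Qed.

Lemma continuity_orbit_prod n : continuity (fun x => orbit_prod g f n (clip 0 1 x)).
Proof.
induction n as [|n IHn]; simpl; [intros x; apply continuity_pt_const; now intros ? ?|].
apply (continuity_mult _ (fun x => g (Nat.iter n f (clip 0 1 x))) IHn).
apply (continuity_eq (fun x => g (clip 0 1 (Nat.iter n f (clip 0 1 x))))).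
- intros x; rewrite clip_id; [reflexivity | apply iter_unit, clip_unit].
- apply (continuity_comp _ (fun y => g (clip 0 1 y)) (continuity_iter_clip n)).
  now apply continue_in_clip.
Qed.

Lemma max_deriv_iter n :
  (exists x, unit_itv x /\
     max_itv (fun x => Rabs (deriv (Nat.iter n f) x)) = Rabs (orbit_prod g f n x)) /\
  (forall x, unit_itv x ->
     Rabs (orbit_prod g f n x) <= max_itv (fun x => Rabs (deriv (Nat.iter n f) x))).
Proof.
destruct (max_itv_spec (fun x => Rabs (deriv (Nat.iter n f) x))) as [[x [x01 Hx]] Hmax].
- apply (continuity_eq (fun x => Rabs (orbit_prod g f n (clip 0 1 x)))).
  + intros x; f_equal; symmetry; apply deriv_eq; [apply clip_unit|].
    apply is_deriv_iter, clip_unit.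
  + apply (continuity_comp _ Rabs (continuity_orbit_prod n)), Rcontinuity_abs.
- assert (E : forall y, unit_itv y -> deriv (Nat.iter n f) y = orbit_prod g f n y)
    by (intros; apply deriv_eq; auto; now apply is_deriv_iter).
  split.
  + exists x; split; [exact x01|]; now rewrite <- Hx, E.
  + intros y y01; rewrite <- E by exact y01; now apply (Hmax y).
Qed.

End UnitMap.

(** * Hölder derivatives *)

Lemma Rpower_gt0 x a : 0 < Rpower x a.
Proof. apply exp_pos. Qed.

Lemma Rabs_le_inv x a : Rabs x <= a -> - a <= x <= a.
Proof. unfold Rabs; destruct (Rcase_abs x); lra. Qed.

Lemma exp_le_exp x y : x <= y -> exp x <= exp y.
Proof. intros [lt | ->]; [left; now apply exp_increasing | right; reflexivity]. Qed.

Lemma ln_le x y : 0 < x -> x <= y -> ln x <= ln y.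
Proof. intros x_gt0 [lt | ->]; [left; now apply ln_increasing | right; reflexivity]. Qed.

Lemma ln_le0 x : 0 < x <= 1 -> ln x <= 0.
Proof. intros x01; rewrite <- ln_1; apply ln_le; lra. Qed.

Lemma Rpower_le_anti x a b : 0 < x <= 1 -> a <= b -> Rpower x b <= Rpower x a.
Proof.
intros x01 ab; apply exp_le_exp; generalize (ln_le0 x x01); nra.
Qed.

Lemma Rpower_le_1 x a : 0 < x <= 1 -> 0 <= a -> Rpower x a <= 1.
Proof.
intros x01 a_ge0; rewrite <- (Rpower_O x) by lra; now apply Rpower_le_anti.
Qed.

Lemma ln_div x y : 0 < x -> 0 < y -> ln (x / y) = ln x - ln y.
Proof.
intros x_gt0 y_gt0; unfold Rdiv.
rewrite ln_mult, ln_Rinv; auto using Rinv_0_lt_compat; ring.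
Qed.

Lemma ln_le_sub1 x : 0 < x -> ln x <= x - 1.
Proof.
intros x_gt0; apply Rnot_lt_le; intros lt.
generalize (exp_ineq1_le (ln x)); rewrite exp_ln by exact x_gt0; lra.
Qed.

Lemma ln_lip m x y : 0 < m -> m <= x -> m <= y -> Rabs (ln x - ln y) <= Rabs (x - y) / m.
Proof.
intros m_gt0.
assert (aux : forall x y, m <= x -> m <= y -> ln x - ln y <= Rabs (x - y) / m).
{ intros u v mu mv.
  rewrite <- ln_div by lra.
  apply Rle_trans with (u / v - 1); [apply ln_le_sub1, Rdiv_lt_0_compat; lra|].
  apply Rle_trans with (Rabs (u - v) / v).
  - replace (u / v - 1) with ((u - v) / v) by (field; lra).
    apply Rmult_le_compat_r; [left; apply Rinv_0_lt_compat; lra | apply Rle_abs].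
  - apply Rmult_le_compat_l; [apply Rabs_pos | apply Rinv_le_contravar; lra]. }
intros mx my; apply Rabs_le; split.
- generalize (aux y x my mx); rewrite Rabs_minus_sym; lra.
- now apply aux.
Qed.

Lemma Rabs_pow_nonneg c a x : 0 <= c -> 0 <= c * Rpower x a.
Proof. intros; apply Rmult_le_pos; [assumption | left; apply Rpower_gt0]. Qed.

Definition holder_deriv (alpha c : R) (f g : R -> R) : Prop :=
  (forall x, derivable_pt_lim f x (g x)) /\
  (forall x y, x <> y -> Rabs (g x - g y) <= c * Rpower (Rabs (x - y)) alpha).

(** Replacing the distance by a positive upper bound [h] also covers the diagonal [x = y]. *)
Lemma holder_le alpha c f g x y h : 0 <= alpha -> 0 <= c -> holder_deriv alpha c f g ->
  0 < h -> Rabs (x - y) <= h -> Rabs (g x - g y) <= c * Rpower h alpha.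
Proof.
intros a_ge0 c_ge0 [_ Hg] h_gt0 xyh.
destruct (Req_dec x y) as [-> | neq].
- rewrite Rminus_diag, Rabs_R0; now apply Rabs_pow_nonneg.
- apply Rle_trans with (1 := Hg x y neq).
  apply Rmult_le_compat_l, Rle_Rpower_l; auto; split; [|exact xyh].
  apply Rabs_pos_lt; lra.
Qed.

Lemma holder_deriv_continuity alpha c f g : 0 < alpha -> 0 <= c ->
  holder_deriv alpha c f g -> continuity f /\ continuity g.
Proof.
intros a_gt0 c_ge0 fg; split.
- intros x; apply derivable_continuous_pt; exists (g x); apply fg.
- intros x e e_gt0.
  exists (Rpower (e / (c + 1)) (/ alpha)); split; [apply Rpower_gt0|].
  intros y [_ xy]; simpl in *; unfold Rdist in *.
  apply Rle_lt_trans with (1 := holder_le _ _ _ _ _ _ _ (Rlt_le _ _ a_gt0) c_ge0 fg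
                             (Rpower_gt0 _ _) (Rlt_le _ _ xy)).
  rewrite Rpower_mult, Rinv_l, Rpower_1 by (try apply Rdiv_lt_0_compat; lra).
  apply Rmult_lt_reg_r with (c + 1); [lra|].
  field_simplify; lra.
Qed.

Lemma MVT_dist f g x y : (forall z, derivable_pt_lim f z (g z)) ->
  exists z, f y - f x = g z * (y - x) /\
    Rabs (z - x) <= Rabs (y - x) /\ Rabs (z - y) <= Rabs (y - x).
Proof.
intros fg; destruct (Rtotal_order x y) as [lt | [<- | lt]].
- destruct (MVT_cor2 f g x y lt) as [z [E Hz]]; [intros; apply fg|].
  exists z; rewrite E; repeat split; rewrite (Rabs_pos_eq (y - x)) by lra;
    apply Rabs_le; lra.
- exists x; rewrite !Rminus_diag, Rabs_R0; split; [ring | lra].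
- destruct (MVT_cor2 f g y x lt) as [z [E Hz]]; [intros; apply fg|].
  exists z; split; [lra|]; rewrite (Rabs_minus_sym y x), (Rabs_pos_eq (x - y)) by lra;
    split; apply Rabs_le; lra.
Qed.

Lemma holder_opp alpha c f g : holder_deriv alpha c f g ->
  holder_deriv alpha c (fun x => - f x) (fun x => - g x).
Proof.
intros [fg Hg]; split.
- intros x; apply (derivable_pt_lim_opp f), fg.
- intros x y neq; replace (- g x - - g y) with (g y - g x) by ring.
  rewrite Rabs_minus_sym; now apply Hg.
Qed.

Lemma holder_reflect alpha c f g : holder_deriv alpha c f g ->
  holder_deriv alpha c (fun x => f (- x)) (fun x => - g (- x)).
Proof.
intros [fg Hg]; split.
- intros x; replace (- g (- x)) with (g (- x) * (- (1))) by ring.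
  apply (derivable_pt_lim_comp (fun x => - x) f); [|apply fg].
  apply (derivable_pt_lim_opp id), derivable_pt_lim_id.
- intros x y neq; replace (- g (- x) - - g (- y)) with (g (- y) - g (- x)) by ring.
  replace (Rabs (x - y)) with (Rabs (- y - - x)) by (f_equal; ring).
  apply Hg; lra.
Qed.

(** * A Glaeser inequality *)

(* Walking from [x] in the direction where [phi] decreases, [phi'] stays above
   [g x / 2] along a length [h] with [c h^alpha = g x / 2], so [phi] cannot vanish
   there. *)
Lemma glaeser_pos alpha c phi g : 0 < alpha -> 1 <= c -> holder_deriv alpha c phi g ->
  (forall x, phi x = 0 -> g x = 0) ->
  forall x, 0 < phi x -> 0 < g x ->
  g x <= 2 * c * Rpower (phi x) (alpha / (1 + alpha)).
Proof.
intros a_gt0 c_ge1 Hphi zeros x phi_gt0 g_gt0.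
set (h := Rpower (g x / (2 * c)) (/ alpha)).
assert (h_gt0 : 0 < h) by apply Rpower_gt0.
assert (Eh : c * Rpower h alpha = g x / 2).
{ unfold h; rewrite Rpower_mult, Rinv_l, Rpower_1 by (try apply Rdiv_lt_0_compat; lra).
  field; lra. }
assert (near : forall y, x - h <= y <= x -> g x / 2 <= g y).
{ intros y xy.
  assert (xyh : Rabs (y - x) <= h) by (apply Rabs_le; lra).
  generalize (holder_le alpha c phi g y x h ltac:(lra) ltac:(lra) Hphi h_gt0 xyh).
  rewrite Eh; unfold Rabs; destruct (Rcase_abs _); lra. }
(* A sign change would produce a zero of [phi] in [[x - h, x]], where [g] would vanish although
   [near] keeps it positive. *)
assert (left_gt0 : 0 < phi (x - h)).
{ apply Rnot_le_lt; intros left_le0.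
  destruct (IVT_cor phi (x - h) x) as [z [xz z0]].
  - apply (holder_deriv_continuity alpha c phi g); auto; lra.
  - lra.
  - nra.
  - generalize (near z xz) (zeros z z0); lra. }
destruct (MVT_cor2 phi g (x - h) x) as [z [E xz]]; [lra | intros; apply Hphi|].
(* The increase of [phi] over a length [h] at slope at least [g x / 2 = c h^alpha]. *)
assert (phi_ge : c * Rpower h (1 + alpha) <= phi x).
{ rewrite Rpower_plus, Rpower_1 by exact h_gt0.
  generalize (near z ltac:(lra)); nra. }
apply Rle_trans with (2 * c * Rpower (Rpower h (1 + alpha)) (alpha / (1 + alpha))).
- rewrite Rpower_mult; replace ((1 + alpha) * (alpha / (1 + alpha))) with alpha
    by (field; lra); lra.
- apply Rmult_le_compat_l; [lra|]; apply Rle_Rpower_l.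
  + apply Rlt_le, Rdiv_lt_0_compat; lra.
  + split; [apply Rpower_gt0|]; generalize (Rpower_gt0 h (1 + alpha)); nra.
Qed.

(** Reflecting the variable reverses the sign of [g] and negating [phi] reverses both signs, which
    reduces all cases to the positive one. *)
Lemma glaeser alpha c phi g : 0 < alpha -> 1 <= c -> holder_deriv alpha c phi g ->
  (forall x, phi x = 0 -> g x = 0) ->
  forall x, phi x <> 0 ->
  Rabs (g x) <= 2 * c * Rpower (Rabs (phi x)) (alpha / (1 + alpha)).
Proof.
intros a_gt0 c_ge1.
assert (aux : forall phi g, holder_deriv alpha c phi g -> (forall x, phi x = 0 -> g x = 0) ->
  forall x, 0 < phi x -> Rabs (g x) <= 2 * c * Rpower (phi x) (alpha / (1 + alpha))).
{ intros p q Hp zeros x p_gt0.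
  destruct (Rtotal_order 0 (q x)) as [lt | [<- | lt]].
  - rewrite Rabs_pos_eq by lra; now apply glaeser_pos.
  - rewrite Rabs_R0; apply Rabs_pow_nonneg; lra.
  - rewrite Rabs_left by lra.
    generalize (glaeser_pos alpha c _ _ a_gt0 c_ge1 (holder_reflect _ _ _ _ Hp)) ; intros H.
    specialize (H ltac:(intros y y0; rewrite (zeros _ y0); ring) (- x)).
    cbv beta in H; rewrite Ropp_involutive in H; apply H; lra. }
intros Hphi zeros x neq.
destruct (Rtotal_order 0 (phi x)) as [lt | [eq | lt]].
- rewrite (Rabs_pos_eq (phi x)) by lra; now apply aux.
- now symmetry in eq.
- rewrite (Rabs_left (phi x)) by lra; rewrite <- Rabs_Ropp.
  apply (aux _ _ (holder_opp _ _ _ _ Hphi)); [|lra].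
  intros y y0; rewrite (zeros y); lra.
Qed.

(** * Growth along an orbit *)

Lemma ln_Rpower x a : ln (Rpower x a) = a * ln x.
Proof. apply ln_exp. Qed.

(** With [t = A d^b]: [e^(-b) >= d^(-b) (1 + t)^(-b) >= d^(-b) (1 - t) = d^(-b) - A]. The power
    [d^(-b)] linearizes the recursion for the step lengths. *)
Lemma Rpower_neg_step b A d e : 0 <= b <= 1 -> 0 <= A -> 0 < d -> 0 < e ->
  e <= d * (1 + A * Rpower d b) -> Rpower d (- b) <= Rpower e (- b) + A.
Proof.
intros b01 A_ge0 d_gt0 e_gt0 ed.
generalize (Rpower_gt0 d b) (Rpower_gt0 d (- b)); intros db_gt0 dnb_gt0.
assert (E : Rpower d (- b) * Rpower d b = 1)
  by (rewrite <- Rpower_plus, Rplus_opp_l; now apply Rpower_O).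
set (t := A * Rpower d b) in *.
assert (t_ge0 : 0 <= t) by (now apply Rmult_le_pos; [|left]).
assert (H1 : Rpower (d * (1 + t)) (- b) <= Rpower e (- b)).
{ rewrite !Rpower_Ropp; apply Rinv_le_contravar; [apply Rpower_gt0|].
  apply Rle_Rpower_l; lra. }
rewrite <- Rpower_mult_distr in H1 by lra.
assert (H2 : Rpower (1 + t) (- (1)) <= Rpower (1 + t) (- b)) by (apply Rle_Rpower; lra).
rewrite Rpower_Ropp, Rpower_1 in H2 by lra.
assert (H3 : 1 - t <= / (1 + t)).
{ apply Rmult_le_reg_r with (1 + t); [lra|]; rewrite Rinv_l by lra; nra. }
assert (H4 : Rpower d (- b) * t = A) by (unfold t; nra).
nra.
Qed.

(** As [e <= 1], [e^(-b)] is at least 1, so the additive bound gives the multiplicative one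
    [d^(-b) <= (1 + B) e^(-b)]; then take logarithms. *)
Lemma Rpower_neg_ln b B d e : 0 < b -> 0 <= B -> 0 < d -> 0 < e <= 1 ->
  Rpower d (- b) <= Rpower e (- b) + B -> ln e - ln d <= ln (1 + B) / b.
Proof.
intros b_gt0 B_ge0 d_gt0 e01 H.
assert (e_ge1 : 1 <= Rpower e (- b)).
{ rewrite Rpower_Ropp, <- Rinv_1; apply Rinv_le_contravar; [apply Rpower_gt0|].
  apply Rpower_le_1; lra. }
assert (H1 : Rpower d (- b) <= Rpower e (- b) * (1 + B)) by nra.
apply ln_le in H1; [|apply Rpower_gt0].
rewrite ln_mult, !ln_Rpower in H1 by lra.
apply Rmult_le_reg_r with b; [exact b_gt0|].
replace (ln (1 + B) / b * b) with (ln (1 + B)) by (field; lra); lra.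
Qed.

(* Dividing by [M ^ alpha], this is [t ^ alpha <= 1 + t] at [t = M d]. *)
Lemma Rpower_le_affine alpha M d : 0 < alpha < 1 -> 0 < M -> 0 < d ->
  Rpower d alpha <= Rpower M (- alpha) * (1 + M * d).
Proof.
intros a01 M_gt0 d_gt0.
assert (Md_gt0 : 0 < M * d) by now apply Rmult_lt_0_compat.
replace (Rpower d alpha) with (Rpower M (- alpha) * Rpower (M * d) alpha).
- apply Rmult_le_compat_l; [left; apply Rpower_gt0|].
  destruct (Rle_lt_dec (M * d) 1).
  + generalize (Rpower_le_1 (M * d) alpha); lra.
  + generalize (Rle_Rpower (M * d) alpha 1); rewrite Rpower_1 by lra; lra.
- rewrite <- Rpower_mult_distr, <- Rmult_assoc, <- Rpower_plus, Rplus_opp_l, Rpower_O by lra.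
  ring.
Qed.

Lemma ln_le_Rpower s x : 0 < s -> 0 < x -> ln x <= Rpower x s / s.
Proof.
intros s_gt0 x_gt0.
generalize (ln_le_sub1 (Rpower x s) (Rpower_gt0 _ _)); rewrite ln_Rpower; intros H.
apply Rmult_le_reg_l with s; [exact s_gt0|].
replace (s * (Rpower x s / s)) with (Rpower x s) by (field; lra); lra.
Qed.

Section Orbit.

Variables (alpha c m : R) (F G : R -> R).
Hypothesis alpha_gt0 : 0 < alpha.
Hypothesis alpha_lt1 : alpha < 1.
Hypothesis c_ge1 : 1 <= c.
Hypothesis m_gt0 : 0 < m.
Hypothesis m_le1 : m <= 1.
Hypothesis F_unit : forall x, unit_itv x -> unit_itv (F x).
Hypothesis G_ge : forall x, m <= G x.
Hypothesis fixed : forall x, F x = x -> G x = 1.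
Hypothesis F_deriv : holder_deriv alpha c (fun x => F x - x) (fun x => G x - 1).

Let beta := alpha / (1 + alpha).
(** The Glaeser constant [2 c] plus the Hölder constant [c]. One division by [m] pays for passing
    from one step length to the next, the other for the factor [rho >= m] in the backward
    estimate. *)
Let A := 3 * c / (m * m).

Local Lemma beta_bounds : 0 < beta <= alpha.
Proof.
unfold beta; split; [apply Rdiv_lt_0_compat; lra|].
apply Rmult_le_reg_r with (1 + alpha); [lra|].
replace (alpha / (1 + alpha) * (1 + alpha)) with alpha by (field; lra); nra.
Qed.

Local Lemma A_ge : 0 < 3 * c <= A.
Proof.
split; [lra|]; unfold A; apply Rmult_le_reg_r with (m * m); [nra|].
replace (3 * c / (m * m) * (m * m)) with (3 * c) by (field; lra).
assert (m * m <= 1) by nra; nra.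
Qed.

(** The ratio [rho] of consecutive displacements is [G z] for a mean value point [z] within
    [|F x - x|] of both [x] and [F x]. Hölder continuity compares it with [G x]; the Glaeser
    inequality at [x] bounds it above and at [F x] below. The last two bounds have the form required
    by [Rpower_neg_step], forwards and backwards in time. *)
Lemma displacement_step x : F x <> x -> Rabs (F x - x) <= 1 ->
  exists rho, m <= rho /\ F (F x) - F x = rho * (F x - x) /\
    Rabs (ln (G x) - ln rho) <= c / m * Rpower (Rabs (F x - x)) alpha /\
    rho <= 1 + A * Rpower (Rabs (F x - x)) beta /\
    1 <= rho * (1 + A * Rpower (rho * Rabs (F x - x)) beta).
Proof.
intros neq le1.
destruct (MVT_dist (fun x => F x - x) (fun x => G x - 1) x (F x)) as [z [E [zx zy]]];
  [exact (proj1 F_deriv)|]; cbv beta in E.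
set (d := Rabs (F x - x)) in *.
assert (d_gt0 : 0 < d) by (apply Rabs_pos_lt; lra).
generalize beta_bounds A_ge; intros b_bounds A_bounds.
assert (zeros : forall y, F y - y = 0 -> G y - 1 = 0)
  by (intros y y0; rewrite fixed; lra).
assert (glaeser_at := glaeser alpha c _ _ alpha_gt0 c_ge1 F_deriv zeros).
cbv beta in glaeser_at; fold beta in glaeser_at.
assert (near : forall y, Rabs (z - y) <= d ->
          Rabs (G z - G y) <= c * Rpower d alpha).
{ intros y zyd; replace (G z - G y) with ((G z - 1) - (G y - 1)) by ring.
  apply (holder_le alpha c _ _ z y d) with (3 := F_deriv); lra. }
assert (dab : Rpower d alpha <= Rpower d beta) by (apply Rpower_le_anti; lra).
assert (E' : F (F x) - F x = G z * (F x - x)) by lra.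
assert (Gz := G_ge z).
assert (Fneq : F (F x) - F x <> 0).
{ rewrite E'; apply Rmult_integral_contrapositive_currified; lra. }
exists (G z); split; [exact Gz|]; split; [exact E'|].
split; [|split].
- apply Rle_trans with (1 := ln_lip m _ _ m_gt0 (G_ge x) Gz).
  rewrite Rabs_minus_sym; unfold Rdiv; rewrite Rmult_assoc, (Rmult_comm (/ m)), <- Rmult_assoc.
  apply Rmult_le_compat_r; [left; now apply Rinv_0_lt_compat | now apply near].
- generalize (near x zx) (glaeser_at x ltac:(lra)) (Rpower_gt0 d beta); fold d.
  intros H1 H2 H3.
  assert (3 * c * Rpower d beta <= A * Rpower d beta) by nra.
  apply Rabs_le_inv in H1; apply Rabs_le_inv in H2.
  assert (c * Rpower d alpha <= c * Rpower d beta) by nra.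
  lra.
- set (e := G z * d).
  assert (Ee : e = Rabs (F (F x) - F x))
    by (rewrite E', Rabs_mult, (Rabs_pos_eq (G z)) by lra; reflexivity).
  assert (e_gt0 : 0 < e) by (rewrite Ee; now apply Rabs_pos_lt).
  generalize (near (F x) zy) (glaeser_at (F x) Fneq); rewrite <- Ee.
  intros H1 H2; apply Rabs_le_inv in H1; apply Rabs_le_inv in H2.
  assert (dm : m * Rpower d beta <= Rpower e beta).
  { apply Rle_trans with (Rpower (m * d) beta).
    - rewrite <- Rpower_mult_distr by lra.
      apply Rmult_le_compat_r; [left; apply Rpower_gt0|].
      rewrite <- (Rpower_1 m) at 1 by lra; apply Rpower_le_anti; lra.
    - apply Rle_Rpower_l; [lra|]; unfold e; nra. }
  assert (H3 : c * Rpower d alpha <= c * Rpower d beta) by nra.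
  assert (H4 : m * (1 - G z) <= 3 * c * Rpower e beta).
  { assert (0 < Rpower e beta) by apply Rpower_gt0.
    assert (m * (c * Rpower d beta) <= c * Rpower e beta) by nra.
    assert (m * (2 * c * Rpower e beta) <= 2 * c * Rpower e beta) by nra.
    nra. }
  assert (H5 : m * m * A = 3 * c) by (unfold A; field; lra).
  assert (H6 : 0 < A * Rpower e beta) by (apply Rmult_lt_0_compat; [lra | apply Rpower_gt0]).
  assert (H7 : 1 - G z <= m * (A * Rpower e beta)).
  { apply Rmult_le_reg_l with m; [exact m_gt0|]; nra. }
  nra.
Qed.

(** The sign [s] of the displacement persists along the orbit because the ratios are positive, so
    the step lengths add up to [s * (y - x)]. Each step of length [d] costs at most
    [c / m * d^alpha], which [Rpower_le_affine] makes affine in [d] so that the sum can be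
    evaluated; [M] is left free to be optimized. *)
Lemma orbit_distortion s x M n : s * s = 1 -> unit_itv x -> 0 < s * (F x - x) -> 0 < M ->
  let y := Nat.iter n F x in
  0 < s * (F y - y) /\
  Rabs (ln (orbit_prod G F n x) - (ln (Rabs (F y - y)) - ln (Rabs (F x - x)))) <=
    c / m * Rpower M (- alpha) * (INR n + M * (s * (y - x))) /\
  Rpower (Rabs (F x - x)) (- beta) <= Rpower (Rabs (F y - y)) (- beta) + INR n * A /\
  Rpower (Rabs (F y - y)) (- beta) <= Rpower (Rabs (F x - x)) (- beta) + INR n * A.
Proof.
intros s1 x01 pos M_gt0.
generalize beta_bounds A_ge; intros b_bounds A_bounds.
induction n as [|n IHn]; intros y.
{ simpl in *; subst y; rewrite ln_1, !Rminus_diag, Rabs_R0.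
  repeat split; lra. }
destruct IHn as [z_pos [IH1 [IH2 IH3]]].
set (z := Nat.iter n F x) in *; change y with (F z); clear y.
assert (z01 : unit_itv z) by (apply (iter_unit F); assumption).
assert (Fz01 := F_unit z z01); unfold unit_itv in z01, Fz01.
destruct (displacement_step z) as [rho [rho_ge [E [H1 [H2 H3]]]]].
{ intros E; rewrite E in z_pos; lra. }
{ apply Rabs_le; lra. }
assert (d_gt0 : 0 < Rabs (F z - z))
  by (apply Rabs_pos_lt; intros E0; rewrite E0 in z_pos; lra).
assert (Ed : Rabs (F z - z) = s * (F z - z)).
{ destruct (Rle_dec 0 s); [rewrite Rabs_pos_eq; nra|].
  rewrite Rabs_left by nra. nra. }
rewrite E, Rabs_mult, (Rabs_pos_eq rho) by lra.
set (d := Rabs (F z - z)) in *.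
split; [nra|]; split; [|split].
- simpl orbit_prod; fold z; rewrite S_INR.
  rewrite ln_mult.
  2: { clear - G_ge m_gt0; induction n; simpl; [lra|].
       apply Rmult_lt_0_compat; [exact IHn|]; eapply Rlt_le_trans; [exact m_gt0 | apply G_ge]. }
  2: { generalize (G_ge z); lra. }
  rewrite ln_mult by lra.
  assert (cm_gt0 : 0 < c / m) by (apply Rdiv_lt_0_compat; lra).
  assert (H4 := Rpower_le_affine alpha M d (conj alpha_gt0 alpha_lt1) M_gt0 d_gt0).
  apply (Rmult_le_compat_l (c / m)) in H4; [|lra].
  apply Rabs_le_inv in H1; apply Rabs_le_inv in IH1.
  replace (s * (F z - x)) with (d + s * (z - x)) by lra.
  apply Rabs_le; lra.
- rewrite S_INR; apply Rle_trans with (1 := IH2).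
  enough (Rpower d (- beta) <= Rpower (rho * d) (- beta) + A) by lra.
  apply Rpower_neg_step; nra.
- rewrite S_INR.
  enough (Rpower (rho * d) (- beta) <= Rpower d (- beta) + A) by lra.
  apply Rpower_neg_step; nra.
Qed.

Lemma orbit_growth : exists C, 0 < C /\ forall n x, (1 <= n)%nat -> unit_itv x ->
  Rabs (ln (orbit_prod G F n x)) <= C * Rpower (INR n) (1 - alpha).
Proof.
generalize beta_bounds A_ge; intros b_bounds A_bounds.
assert (cm_gt0 : 0 < c / m) by (apply Rdiv_lt_0_compat; lra).
assert (K_gt0 : 0 < A + / (1 - alpha)) by (generalize (Rinv_0_lt_compat (1 - alpha)); lra).
(* The first term bounds the accumulated distortion, the second the telescoping logarithms. *)
exists (2 * (c / m) + (A + / (1 - alpha)) / beta); split.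
{ apply Rplus_lt_0_compat; [lra | apply Rdiv_lt_0_compat; lra]. }
intros n x n_ge1 x01.
assert (n_ge1' : 1 <= INR n) by (replace 1 with (INR 1) by reflexivity; now apply le_INR).
set (P := Rpower (INR n) (1 - alpha)).
assert (P_ge1 : 1 <= P).
{ rewrite <- (Rpower_O (INR n)) by lra; apply Rle_Rpower; lra. }
destruct (Req_dec (F x) x) as [Fx | neq].
{ replace (orbit_prod G F n x) with 1.
  - rewrite ln_1, Rabs_R0; apply Rmult_le_pos; [|lra].
    apply Rplus_le_le_0_compat; [lra | left; apply Rdiv_lt_0_compat; lra].
  - assert (fix_iter : forall k, Nat.iter k F x = x)
      by (induction k as [|k IHk]; simpl; [reflexivity | now rewrite IHk]).
    clear - Fx fixed fix_iter; induction n; simpl; [reflexivity|].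
    rewrite <- IHn, fix_iter, fixed by exact Fx; ring. }
assert (sign : exists s, s * s = 1 /\ 0 < s * (F x - x) /\ (s = 1 \/ s = - (1))).
{ destruct (Rlt_dec x (F x)); [exists 1 | exists (- (1))]; lra. }
destruct sign as [s [s1 [pos s_cases]]].
(* With [M = n] the two parts of the affine error balance: each sums to at most a constant times
   [n^(1 - alpha)], since the orbit travels at most distance 1. *)
destruct (orbit_distortion s x (INR n) n s1 x01 pos ltac:(lra)) as [y_pos [H1 [H2 H3]]].
set (y := Nat.iter n F x) in *.
assert (y01 : unit_itv y) by (apply (iter_unit F); assumption).
assert (Fx01 := F_unit x x01); assert (Fy01 := F_unit y y01); unfold unit_itv in *.
assert (dx : 0 < Rabs (F x - x) <= 1)
  by (split; [apply Rabs_pos_lt; lra | apply Rabs_le; lra]).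
assert (dy : 0 < Rabs (F y - y) <= 1).
{ split; [apply Rabs_pos_lt; intros E0; rewrite E0 in y_pos; lra | apply Rabs_le; lra]. }
assert (nA_ge0 : 0 <= INR n * A) by nra.
apply Rpower_neg_ln in H2; try lra; apply Rpower_neg_ln in H3; try lra.
(* The telescoping part grows only like [ln n], which is at most [n^(1 - alpha) / (1 - alpha)]. *)
assert (H4 : ln (1 + INR n * A) / beta <= (A + / (1 - alpha)) / beta * P).
{ unfold Rdiv; rewrite Rmult_assoc, (Rmult_comm (/ beta)), <- Rmult_assoc.
  apply Rmult_le_compat_r; [left; apply Rinv_0_lt_compat; lra|].
  apply Rle_trans with (ln ((1 + A) * INR n)); [apply ln_le; nra|].
  rewrite ln_mult by lra.
  generalize (ln_le_sub1 (1 + A) ltac:(lra)).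
  generalize (ln_le_Rpower (1 - alpha) (INR n) ltac:(lra) ltac:(lra)); fold P.
  unfold Rdiv; nra. }
assert (H5 : c / m * Rpower (INR n) (- alpha) * (INR n + INR n * (s * (y - x))) <=
             2 * (c / m) * P).
{ assert (s * (y - x) <= 1) by (destruct s_cases; subst s; lra).
  assert (E : P = INR n * Rpower (INR n) (- alpha)).
  { unfold P; replace (1 - alpha) with (1 + - alpha) by ring.
    rewrite Rpower_plus, Rpower_1 by lra; reflexivity. }
  rewrite E; generalize (Rpower_gt0 (INR n) (- alpha)); intros.
  set (Q := Rpower (INR n) (- alpha)) in *.
  replace (2 * (c / m) * (INR n * Q)) with (c / m * Q * (INR n + INR n * 1)) by ring.
  apply Rmult_le_compat_l; [apply Rmult_le_pos; lra|].
  apply Rplus_le_compat_l, Rmult_le_compat_l; lra. }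
apply Rabs_le_inv in H1; apply Rabs_le; lra.
Qed.

End Orbit.

(** * The upper bound *)

(* The identity outside [0,1], so that a diffeomorphism tangent to the identity at
   both endpoints becomes a diffeomorphism of the line. *)
Definition extend (f : R -> R) (x : R) : R := f (clip 0 1 x) + (x - clip 0 1 x).

Lemma extend_unit f x : unit_itv x -> extend f x = f x.
Proof. intros x01; unfold extend; rewrite clip_id by exact x01; ring. Qed.

Lemma clip_shift_locally_constant x : ~ (0 < x < 1) \/
  exists d, 0 < d /\ forall y, Rabs (y - x) < d -> y - clip 0 1 y = x - clip 0 1 x.
Proof.
destruct (Rle_dec x 0); [left; lra|]; destruct (Rle_dec 1 x); [left; lra|].
right; exists (Rmin x (1 - x)); split; [apply Rmin_glb_lt; lra|].
intros y Hy; apply Rabs_def2 in Hy.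
generalize (Rmin_l x (1 - x)) (Rmin_r x (1 - x)); intros.
rewrite !clip_id; lra.
Qed.

(** The first-order error of [extend f] at [x] equals that of [f] at the clipped points: in the
    interior because the shift [y - clip 0 1 y] is locally constant, elsewhere because the slope
    there is 1. Clipping does not increase distances, so the error remains small relative to the
    increment. *)
Lemma derivable_extend f g x : (forall x, unit_itv x -> is_deriv f x (g x)) ->
  g 0 = 1 -> g 1 = 1 -> derivable_pt_lim (extend f) x (g (clip 0 1 x)).
Proof.
intros f_deriv g0 g1 e e_gt0.
set (u := clip 0 1 x).
assert (split_error : exists d, 0 < d /\ forall y, Rabs (y - x) < d ->
  extend f y - extend f x - g u * (y - x) =
  f (clip 0 1 y) - f u - g u * (clip 0 1 y - u)).
{ destruct (clip_shift_locally_constant x) as [end_pt | [d [d_gt0 Hd]]].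
  - assert (gu : g u = 1).
    { unfold u; destruct (Rle_dec x 0); [rewrite clip_left | rewrite clip_right]; lra. }
    exists 1; split; [lra|]; intros y _; unfold extend; fold u; rewrite gu; ring.
  - exists d; split; [exact d_gt0|]; intros y Hy; unfold extend; fold u.
    specialize (Hd y Hy); fold u in Hd; rewrite Hd.
    replace (y - x) with (clip 0 1 y - u) by lra; ring. }
destruct split_error as [d1 [d1_gt0 H1]].
destruct (f_deriv u (clip_unit x) (e / 2) ltac:(lra)) as [d2 [d2_gt0 H2]].
assert (d_gt0 : 0 < Rmin d1 d2) by now apply Rmin_glb_lt.
exists (mkposreal _ d_gt0); intros h h_neq0 Hh; simpl in *.
generalize (Rmin_l d1 d2) (Rmin_r d1 d2); intros.
specialize (H1 (x + h)); replace (x + h - x) with h in H1 by ring.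
specialize (H1 ltac:(lra)).
set (v := clip 0 1 (x + h)) in *.
assert (uv : Rabs (v - u) <= Rabs h).
{ replace h with (x + h - x) by ring; apply clip_lip. }
replace ((extend f (x + h) - extend f x) / h - g u) with
  ((extend f (x + h) - extend f x - g u * h) / h) by (field; exact h_neq0).
rewrite H1; clear H1.
assert (h_gt0 := Rabs_pos_lt h h_neq0).
unfold Rdiv; rewrite Rabs_mult, Rabs_inv.
apply Rmult_lt_reg_r with (Rabs h); [exact h_gt0|].
rewrite Rmult_assoc, Rinv_l, Rmult_1_r by lra.
destruct (Req_dec u v) as [<- | neq].
- replace (f u - f u - g u * (u - u)) with 0 by ring; rewrite Rabs_R0; nra.
- specialize (H2 v); unfold Rdist in H2.
  replace (f v - f u - g u * (v - u)) with (((f v - f u) / (v - u) - g u) * (v - u))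
    by (field; lra).
  rewrite Rabs_mult.
  apply Rle_lt_trans with (e / 2 * Rabs h); [|nra].
  apply Rmult_le_compat; try apply Rabs_pos; [|exact uv].
  left; apply H2; split; [split; [apply clip_unit | exact neq] | lra].
Qed.

(** * Inverse diffeomorphisms, and the growth sequence in terms of orbits of [f] alone *)

Lemma Diff1_deriv f x : Diff1 f -> unit_itv x -> is_deriv f x (deriv f x).
Proof. intros Hf x01; now apply Hf. Qed.

Lemma Diff1_unit f x : Diff1 f -> unit_itv x -> unit_itv (f x).
Proof. intros Hf; apply Hf. Qed.

Lemma inv_itv_spec f y : bij_itv f -> unit_itv y ->
  unit_itv (inv_itv f y) /\ f (inv_itv f y) = y.
Proof.
intros [_ [_ surj]] y01; unfold inv_itv.
apply (epsilon_spec (inhabits 0) (fun x => unit_itv x /\ f x = y)), surj, y01.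
Qed.

Lemma inv_itv_cancel f x : bij_itv f -> unit_itv x -> inv_itv f (f x) = x.
Proof.
intros bij x01; destruct (inv_itv_spec f (f x) bij) as [H1 H2]; [now apply bij|].
now apply bij.
Qed.

Lemma deriv_inv_itv f x : Diff1 f -> unit_itv x ->
  deriv f x * deriv (inv_itv f) (f x) = 1.
Proof.
intros Hf x01.
assert (fx01 := Diff1_unit f x Hf x01).
assert (comp : is_deriv (fun y => inv_itv f (f y)) x
                 (deriv f x * deriv (inv_itv f) (f x))).
{ apply is_deriv_comp; [exact x01 | apply Hf | now apply Diff1_deriv | now apply Hf]. }
assert (id_deriv : is_deriv (fun y => inv_itv f (f y)) x 1).
{ apply (is_deriv_ext id); [exact x01 | | apply is_deriv_global, derivable_pt_lim_id].
  intros y y01; symmetry; apply inv_itv_cancel; [apply Hf | exact y01]. }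
rewrite <- (deriv_eq _ _ _ x01 comp); now apply deriv_eq.
Qed.

Lemma orbit_prod_succ_l g f n x : orbit_prod g f (S n) x = g x * orbit_prod g f n (f x).
Proof.
induction n as [|n IHn]; [simpl; ring|].
change (orbit_prod g f (S n) x * g (Nat.iter (S n) f x) =
        g x * (orbit_prod g f n (f x) * g (Nat.iter n f (f x)))).
rewrite IHn, Nat.iter_succ_r; ring.
Qed.

(** An orbit of the inverse is an orbit of [f] run backwards, and the factors cancel in pairs.
    Peeling off the first factor for [f] matches the last one for the inverse. *)
Lemma orbit_prod_inv f n y : Diff1 f -> unit_itv y ->
  orbit_prod (deriv (inv_itv f)) (inv_itv f) n y *
  orbit_prod (deriv f) f n (Nat.iter n (inv_itv f) y) = 1.
Proof.
intros Hf y01; assert (bij : bij_itv f) by apply Hf.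
induction n as [|n IHn]; [simpl; ring|].
rewrite (orbit_prod_succ_l (deriv f)); simpl.
set (z := Nat.iter n (inv_itv f) y) in *.
assert (z01 : unit_itv z)
  by (apply iter_unit; [intros; now apply inv_itv_spec | exact y01]).
destruct (inv_itv_spec f z bij z01) as [w01 Hw].
generalize (deriv_inv_itv f (inv_itv f z) Hf w01); rewrite Hw; intros H.
set (p := orbit_prod _ _ n y) in *; set (q := orbit_prod _ _ n z) in *.
transitivity ((p * q) * (deriv f (inv_itv f z) * deriv (inv_itv f) z)); [ring|].
rewrite IHn, H; ring.
Qed.

(** If the maximum comes from the inverse, it is the reciprocal of the product for [f] at the
    backward image of the maximizing point. *)
Lemma Gamma_bounds f n : Diff1 f ->
  (forall x, unit_itv x -> Rabs (orbit_prod (deriv f) f n x) <= Gamma f n) /\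
  exists x, unit_itv x /\
    (Gamma f n = Rabs (orbit_prod (deriv f) f n x) \/
     Gamma f n = / Rabs (orbit_prod (deriv f) f n x)).
Proof.
intros Hf; assert (bij : bij_itv f) by apply Hf.
assert (inv_unit : forall y, unit_itv y -> unit_itv (inv_itv f y))
  by (intros; now apply inv_itv_spec).
destruct (max_deriv_iter f (deriv f) (fun x => Diff1_unit f x Hf)
            (fun x => Diff1_deriv f x Hf) (fun x x01 => proj2 (proj1 (proj2 Hf) x x01)) n)
  as [[x [x01 Hx]] Hmax].
destruct (max_deriv_iter (inv_itv f) (deriv (inv_itv f)) inv_unit
            (fun x x01 => proj1 (proj1 (proj2 (proj2 Hf)) x x01))
            (fun x x01 => proj2 (proj1 (proj2 (proj2 Hf)) x x01)) n)
  as [[y [y01 Hy]] _].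
unfold Gamma; split.
- intros z z01; apply Rle_trans with (2 := Rmax_l _ _); now apply Hmax.
- apply Rmax_case.
  + exists x; auto.
  + exists (Nat.iter n (inv_itv f) y); split; [now apply iter_unit|]; right.
    rewrite Hy; generalize (orbit_prod_inv f n y Hf y01).
    set (p := orbit_prod _ _ n y); set (q := orbit_prod _ _ n _); intros pq.
    assert (q_neq0 : q <> 0) by (intros q0; rewrite q0, Rmult_0_r in pq; lra).
    rewrite <- Rabs_inv; f_equal; apply Rmult_eq_reg_r with q; [|exact q_neq0].
    now rewrite pq, Rinv_l.
Qed.

(** The derivative has no zero, since its product with that of the inverse is 1. Being continuous
    and equal to 1 at 0, it is positive, and its minimum on [[0,1]] is attained. *)
Lemma Diff1_deriv_pos f : Diff1 f -> deriv f 0 = 1 ->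
  exists m, 0 < m <= 1 /\ forall x, unit_itv x -> m <= deriv f x.
Proof.
intros Hf f0.
set (g := fun x => deriv f (clip 0 1 x)).
assert (g_cont : continuity g) by (apply continue_in_clip; intros; now apply Hf).
assert (g_neq0 : forall x, g x <> 0).
{ intros x gx; generalize (deriv_inv_itv f (clip 0 1 x) Hf (clip_unit x)).
  fold (g x); rewrite gx; lra. }
destruct (continuity_ab_min g 0 1) as [x [Hx x01]]; [lra | intros; apply g_cont|].
assert (gx_gt0 : 0 < g x).
{ apply Rnot_le_lt; intros gx_le0.
  destruct (IVT_cor g 0 x g_cont) as [z [_ z0]]; [lra | | now apply (g_neq0 z)].
  assert (g 0 = 1) by (unfold g; rewrite clip_id; [exact f0 | lra]); nra. }
exists (Rmin 1 (g x)); split; [split; [apply Rmin_glb_lt; lra | apply Rmin_l]|].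
intros y y01; apply Rle_trans with (1 := Rmin_r _ _).
generalize (Hx y y01); unfold g; now rewrite (clip_id 0 1 y).
Qed.

Lemma growth_upper_bound alpha f : 0 < alpha < 1 ->
  Diff1_Lip alpha f -> (forall x, ~ E1_itv f x) ->
  exists C, 0 < C /\ forall n, (1 <= n)%nat ->
    Rabs (ln (Gamma f n)) <= C * Rpower (INR n) (1 - alpha).
Proof.
intros a01 [Hf [c Hc]] noE1.
assert (tangent : forall x, unit_itv x -> f x = x -> deriv f x = 1).
{ intros x x01 fx; destruct (Req_dec (deriv f x) 1) as [|neq]; [assumption|].
  now destruct (noE1 x). }
assert (unit0 : unit_itv 0) by (unfold unit_itv; lra).
assert (unit1 : unit_itv 1) by (unfold unit_itv; lra).
assert (d0 : deriv f 0 = 1) by (apply tangent; [exact unit0 | apply Hf]).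
assert (d1 : deriv f 1 = 1) by (apply tangent; [exact unit1 | apply Hf]).
destruct (Diff1_deriv_pos f Hf d0) as [m [m01 Hm]].
set (G := fun x => deriv f (clip 0 1 x)).
(* The constant is raised to at least 1, as the orbit estimates require; clipping preserves the
   Hölder bound. *)
assert (F_deriv : holder_deriv alpha (Rmax 1 c) (fun x => extend f x - x) (fun x => G x - 1)).
{ split.
  - intros x; apply (derivable_pt_lim_minus (extend f) id); [|apply derivable_pt_lim_id].
    apply (derivable_extend f (deriv f)); auto; intros; now apply Diff1_deriv.
  - intros x y neq; replace (G x - 1 - (G y - 1)) with (G x - G y) by ring; unfold G.
    assert (c_ge1 := Rmax_l 1 c); assert (c_max := Rmax_r 1 c).
    destruct (Req_dec (clip 0 1 x) (clip 0 1 y)) as [-> | neq'].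
    + rewrite Rminus_diag, Rabs_R0; apply Rabs_pow_nonneg; lra.
    + apply Rle_trans with (1 := Hc _ _ (clip_unit x) (clip_unit y) neq').
      apply Rmult_le_compat; [| left; apply Rpower_gt0 | exact c_max |].
      * apply Rnot_lt_le; intros c_lt0.
        generalize (Hc _ _ (clip_unit x) (clip_unit y) neq').
        generalize (Rabs_pos (deriv f (clip 0 1 x) - deriv f (clip 0 1 y))).
        generalize (Rpower_gt0 (Rabs (clip 0 1 x - clip 0 1 y)) alpha); nra.
      * apply Rle_Rpower_l; [lra|]; split; [apply Rabs_pos_lt; lra | apply clip_lip]. }
assert (orbits : forall n x, unit_itv x ->
  Nat.iter n (extend f) x = Nat.iter n f x /\
  orbit_prod G (extend f) n x = orbit_prod (deriv f) f n x).
{ intros n x x01; induction n as [|n [IH1 IH2]]; [now split|].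
  assert (y01 : unit_itv (Nat.iter n f x)) by (apply iter_unit; [apply Hf | exact x01]).
  simpl; rewrite IH1, IH2; split; [now apply extend_unit|].
  unfold G; now rewrite clip_id. }
destruct (orbit_growth alpha (Rmax 1 c) m (extend f) G) as [C [C_gt0 HC]]; try lra.
- apply Rmax_l.
- intros x x01; rewrite extend_unit by exact x01; now apply Hf.
- intros x; apply Hm, clip_unit.
- intros x Fx; apply tangent; [apply clip_unit | unfold extend in Fx; lra].
- exact F_deriv.
- exists C; split; [exact C_gt0|]; intros n n_ge1.
  (* The two-sided bound on the logarithm of the product serves equally for its reciprocal. *)
  destruct (proj2 (Gamma_bounds f n Hf)) as [x [x01 Hx]].
  generalize (HC n x n_ge1 x01); rewrite (proj2 (orbits n x x01)).
  assert (p_gt0 : forall k, 0 < orbit_prod (deriv f) f k x).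
  { induction k; simpl; [lra|]; apply Rmult_lt_0_compat; [assumption|].
    apply Rlt_le_trans with m; [lra|]; apply Hm, iter_unit; [apply Hf | exact x01]. }
  specialize (p_gt0 n); rewrite (Rabs_pos_eq (orbit_prod _ _ _ _)) in Hx by lra.
  destruct Hx as [-> | ->]; [auto|].
  now rewrite ln_Rinv, Rabs_Ropp.
Qed.

(** * Bumps with an oscillating plateau *)

Lemma derivable_pt_lim_affine a b x : derivable_pt_lim (fun y => a * y + b) x a.
Proof.
assert (H := derivable_pt_lim_plus (fun y => a * y) (fun _ => b) x _ _
  (derivable_pt_lim_scal id a x 1 (derivable_pt_lim_id x)) (derivable_pt_lim_const b x)).
rewrite Rmult_1_r, Rplus_0_r in H; exact H.
Qed.

Lemma derivable_comp_affine f g a b x : derivable_pt_lim f (a * x + b) (g (a * x + b)) ->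
  derivable_pt_lim (fun y => f (a * y + b)) x (a * g (a * x + b)).
Proof.
intros fg; rewrite Rmult_comm.
exact (derivable_pt_lim_comp (fun y => a * y + b) f x _ _ (derivable_pt_lim_affine a b x) fg).
Qed.

(** Freezing a function at two critical points keeps it differentiable. If [g] vanishes at the
    clipped point, the quotient tends to 0 because clipping is 1-Lipschitz; otherwise [x] lies
    strictly between [a] and [b] and clipping is the identity nearby. *)
Lemma derivable_clip a b f g x : a <= b -> g a = 0 -> g b = 0 ->
  (forall y, derivable_pt_lim f y (g y)) ->
  derivable_pt_lim (fun y => f (clip a b y)) x (g (clip a b x)).
Proof.
intros ab ga gb fg.
destruct (Req_dec (g (clip a b x)) 0) as [gx | gx].
- rewrite gx; intros e e_gt0.
  destruct (fg (clip a b x) e e_gt0) as [d Hd]; rewrite gx in Hd.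
  exists d; intros h h_neq0 Hh.
  set (u := clip a b x) in *; set (v := clip a b (x + h)).
  assert (uv : Rabs (v - u) <= Rabs h).
  { replace h with (x + h - x) by ring; apply clip_lip. }
  assert (h_gt0 := Rabs_pos_lt h h_neq0).
  rewrite Rminus_0_r; unfold Rdiv; rewrite Rabs_mult, Rabs_inv.
  apply Rmult_lt_reg_r with (Rabs h); [exact h_gt0|].
  rewrite Rmult_assoc, Rinv_l, Rmult_1_r by lra.
  destruct (Req_dec (v - u) 0) as [E | neq].
  + replace v with u by lra; rewrite Rminus_diag, Rabs_R0; nra.
  + specialize (Hd (v - u) neq ltac:(lra)).
    replace (u + (v - u)) with v in Hd by ring; rewrite Rminus_0_r in Hd.
    replace (f v - f u) with ((f v - f u) / (v - u) * (v - u)) by (field; exact neq).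
    rewrite Rabs_mult; apply Rlt_le_trans with (e * Rabs (v - u)).
    * apply Rmult_lt_compat_r; [now apply Rabs_pos_lt | exact Hd].
    * apply Rmult_le_compat_l; lra.
- assert (x_in : a < x < b).
  { destruct (Rle_dec x a); [rewrite clip_left in gx; lra|].
    destruct (Rle_dec b x); [rewrite clip_right in gx; lra|lra]. }
  rewrite (clip_id a b x) by lra.
  intros e e_gt0; destruct (fg x e e_gt0) as [d Hd].
  assert (r_gt0 : 0 < Rmin d (Rmin (x - a) (b - x)))
    by (repeat apply Rmin_glb_lt; try lra; apply cond_pos).
  exists (mkposreal _ r_gt0); intros h h_neq0 Hh; simpl in Hh.
  generalize (Rmin_l d (Rmin (x - a) (b - x))) (Rmin_r d (Rmin (x - a) (b - x)))
    (Rmin_l (x - a) (b - x)) (Rmin_r (x - a) (b - x)); intros.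
  assert (Hh' := Rabs_def2 _ _ Hh).
  rewrite !clip_id by lra; apply Hd; [exact h_neq0 | lra].
Qed.

(** The cubic Hermite step from 0 to 1, critical at both ends. *)
Definition smoothstep (t : R) : R := let u := clip 0 1 t in u * u * (3 - 2 * u).

Definition smoothstep' (t : R) : R := let u := clip 0 1 t in 6 * u * (1 - u).

Lemma derivable_smoothstep t : derivable_pt_lim smoothstep t (smoothstep' t).
Proof.
apply (derivable_clip 0 1 (fun u => u * u * (3 - 2 * u)) (fun u => 6 * u * (1 - u)));
  try lra.
intros u.
replace (6 * u * (1 - u)) with ((1 * u + u * 1) * (3 - 2 * u) + (u * u) * - 2) by ring.
apply (derivable_pt_lim_mult (fun u => u * u) (fun u => 3 - 2 * u)).
- apply (derivable_pt_lim_mult id id); apply derivable_pt_lim_id.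
- intros e e_gt0.
  destruct (derivable_pt_lim_affine (- 2) 3 u e e_gt0) as [d Hd]; exists d.
  intros h h_neq0 Hh.
  replace (3 - 2 * (u + h) - (3 - 2 * u)) with (- 2 * (u + h) + 3 - (- 2 * u + 3)) by ring.
  now apply Hd.
Qed.

Lemma smoothstep_bounds t : 0 <= smoothstep t <= 1.
Proof.
unfold smoothstep; generalize (clip_unit t); unfold unit_itv.
set (u := clip 0 1 t); intros u01.
assert (0 <= u * u * (1 - u)) by (repeat apply Rmult_le_pos; lra).
assert (0 <= (1 - u) * (1 - u) * (1 + 2 * u)) by (repeat apply Rmult_le_pos; lra).
nra.
Qed.

Lemma smoothstep'_bounds t : 0 <= smoothstep' t <= 3 / 2.
Proof.
unfold smoothstep'; generalize (clip_unit t); unfold unit_itv.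
generalize (Rle_0_sqr (clip 0 1 t - 1 / 2)); unfold Rsqr; nra.
Qed.

Lemma smoothstep'_lip t u : Rabs (smoothstep' t - smoothstep' u) <= 6 * Rabs (t - u).
Proof.
unfold smoothstep'; generalize (clip_unit t) (clip_unit u) (clip_lip 0 1 t u).
unfold unit_itv; set (v := clip 0 1 t); set (w := clip 0 1 u); intros.
replace (6 * v * (1 - v) - 6 * w * (1 - w)) with (6 * (1 - v - w) * (v - w)) by ring.
rewrite Rabs_mult; apply Rmult_le_compat; try apply Rabs_pos; [apply Rabs_le; lra | lra].
Qed.

Lemma smoothstep_left t : t <= 0 -> smoothstep t = 0 /\ smoothstep' t = 0.
Proof. intros; unfold smoothstep, smoothstep'; rewrite clip_left by lra; lra. Qed.

Lemma smoothstep_right t : 1 <= t -> smoothstep t = 1 /\ smoothstep' t = 0.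
Proof. intros; unfold smoothstep, smoothstep'; rewrite clip_right by lra; lra. Qed.

Lemma cos_lip x y : Rabs (cos x - cos y) <= Rabs (x - y).
Proof.
destruct (MVT_dist cos (fun z => - sin z) y x) as [z [-> _]]; [apply derivable_pt_lim_cos|].
rewrite Rabs_mult, Rabs_Ropp.
rewrite <- (Rmult_1_l (Rabs (x - y))) at 2.
apply Rmult_le_compat_r; [apply Rabs_pos|]; apply Rabs_le; generalize (SIN_bound z); lra.
Qed.

Section Wave.

Variables (eps : R) (N : nat).
Hypothesis eps_gt0 : 0 < eps.
Hypothesis eps_le : eps <= 1 / 32.

(* The clipping points are maxima of the sine, so the oscillation is [C^1] and
   constant outside [1/4, N + 1/4]; the factor [1 + eps] makes the wave equal to [1]
   at the integers [1, ..., N]. *)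
Definition wave (y : R) : R :=
  (1 + eps) * (smoothstep (eps * y + 1) - smoothstep (eps * y + - (eps * (INR N + 1)))) +
  eps * (sin (2 * PI * clip (1 / 4) (INR N + 1 / 4) y) - 1).

Definition wave' (y : R) : R :=
  (1 + eps) * (eps * smoothstep' (eps * y + 1) -
               eps * smoothstep' (eps * y + - (eps * (INR N + 1)))) +
  eps * (2 * PI * cos (2 * PI * clip (1 / 4) (INR N + 1 / 4) y)).

Lemma quarter_le : 1 / 4 <= INR N + 1 / 4.
Proof. generalize (pos_INR N); lra. Qed.

Lemma sin_quarter : sin (2 * PI * (1 / 4)) = 1 /\ cos (2 * PI * (1 / 4)) = 0.
Proof.
replace (2 * PI * (1 / 4)) with (PI / 2) by field; split; [apply sin_PI2 | apply cos_PI2].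
Qed.

Lemma sin_quarter_N :
  sin (2 * PI * (INR N + 1 / 4)) = 1 /\ cos (2 * PI * (INR N + 1 / 4)) = 0.
Proof.
replace (2 * PI * (INR N + 1 / 4)) with (2 * PI * (1 / 4) + 2 * INR N * PI) by ring.
rewrite sin_period, cos_period; apply sin_quarter.
Qed.

Lemma derivable_wave y : derivable_pt_lim wave y (wave' y).
Proof.
unfold wave, wave'.
apply (derivable_pt_lim_plus (fun y => (1 + eps) * _) (fun y => eps * _)).
- apply (derivable_pt_lim_scal (fun y => _ - _)).
  apply (derivable_pt_lim_minus (fun y => smoothstep (eps * y + _))
           (fun y => smoothstep (eps * y + _)));
    apply derivable_comp_affine, derivable_smoothstep.
- apply (derivable_pt_lim_scal (fun y => _ - 1)).
  rewrite <- (Rminus_0_r (2 * PI * _)).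
  apply (derivable_pt_lim_minus (fun y => sin _) (fun _ => 1)); [|apply derivable_pt_lim_const].
  apply (derivable_clip _ _ (fun z => sin (2 * PI * z)) (fun z => 2 * PI * cos (2 * PI * z))).
  + apply quarter_le.
  + rewrite (proj2 sin_quarter); ring.
  + rewrite (proj2 sin_quarter_N); ring.
  + intros z; generalize (derivable_comp_affine sin cos (2 * PI) 0 z (derivable_pt_lim_sin _)).
    rewrite Rplus_0_r; intros H e e_gt0; destruct (H e e_gt0) as [d Hd]; exists d.
    intros h h_neq0 Hh; specialize (Hd h h_neq0 Hh); now rewrite !Rplus_0_r in Hd.
Qed.

Lemma wave_outside y : y <= - / eps \/ INR N + 1 + / eps <= y -> wave y = 0 /\ wave' y = 0.
Proof.
intros Hy; unfold wave, wave'.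
assert (inv_gt0 := Rinv_0_lt_compat _ eps_gt0); assert (E := Rinv_r eps ltac:(lra)).
assert (N_ge0 := pos_INR N); assert (le := quarter_le).
destruct Hy as [Hy | Hy].
- destruct (smoothstep_left (eps * y + 1)) as [-> ->]; [nra|].
  destruct (smoothstep_left (eps * y + - (eps * (INR N + 1)))) as [-> ->]; [nra|].
  rewrite clip_left by lra; destruct sin_quarter as [-> ->]; split; ring.
- destruct (smoothstep_right (eps * y + 1)) as [-> ->]; [nra|].
  destruct (smoothstep_right (eps * y + - (eps * (INR N + 1)))) as [-> ->]; [nra|].
  rewrite clip_right by lra; destruct sin_quarter_N as [-> ->]; split; ring.
Qed.

(** The ramps occupy [[- / eps, 0]] and [[N + 1, N + 1 + / eps]], so both are at rest wherever the
    sine oscillates. *)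
Lemma wave_plateau y : 0 <= y <= INR N + 1 ->
  smoothstep (eps * y + 1) = 1 /\ smoothstep' (eps * y + 1) = 0 /\
  smoothstep (eps * y + - (eps * (INR N + 1))) = 0 /\
  smoothstep' (eps * y + - (eps * (INR N + 1))) = 0.
Proof.
intros Hy; destruct (smoothstep_right (eps * y + 1)) as [-> ->]; [nra|].
destruct (smoothstep_left (eps * y + - (eps * (INR N + 1)))) as [-> ->]; [nra|].
repeat split.
Qed.

(** Outside the oscillation the sine term is 0 and the difference of the ramps is nonnegative, one
    of them being at rest; on the plateau the value is at least [1 - eps]. *)
Lemma wave_ge0 y : 0 <= wave y.
Proof.
assert (N_ge0 := pos_INR N); assert (le := quarter_le).
unfold wave.
destruct (Rle_dec y (1 / 4)); [|destruct (Rle_dec (INR N + 1 / 4) y)].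
- rewrite clip_left, (proj1 sin_quarter) by lra.
  destruct (smoothstep_left (eps * y + - (eps * (INR N + 1)))) as [-> _]; [nra|].
  generalize (smoothstep_bounds (eps * y + 1)); nra.
- rewrite clip_right, (proj1 sin_quarter_N) by lra.
  destruct (smoothstep_right (eps * y + 1)) as [-> _]; [nra|].
  generalize (smoothstep_bounds (eps * y + - (eps * (INR N + 1)))); nra.
- destruct (wave_plateau y) as [-> [_ [-> _]]]; [lra|].
  generalize (SIN_bound (2 * PI * clip (1 / 4) (INR N + 1 / 4) y)); nra.
Qed.

(** At integers the sine vanishes and the cosine is 1: the displacement is exactly one period while
    the slope is at its largest on the plateau. *)
Lemma wave_integer k : (1 <= k <= N)%nat -> wave (INR k) = 1 /\ wave' (INR k) = eps * (2 * PI).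
Proof.
intros [k_ge1 k_le]; apply le_INR in k_ge1; apply le_INR in k_le; simpl in k_ge1.
unfold wave, wave'; rewrite !clip_id by lra.
destruct (wave_plateau (INR k)) as [-> [-> [-> ->]]]; [lra|].
replace (2 * PI * INR k) with (0 + 2 * INR k * PI) by ring.
rewrite sin_period, cos_period, sin_0, cos_0; split; ring.
Qed.

Lemma wave'_bound y : Rabs (wave' y) <= 11 * eps.
Proof.
unfold wave'.
generalize (smoothstep'_bounds (eps * y + 1)).
generalize (smoothstep'_bounds (eps * y + - (eps * (INR N + 1)))).
generalize (COS_bound (2 * PI * clip (1 / 4) (INR N + 1 / 4) y)).
set (s := smoothstep' _); set (t := smoothstep' _); set (u := cos _).
generalize PI_4 PI_RGT_0; intros.
replace ((1 + eps) * (eps * t - eps * s) + eps * (2 * PI * u)) with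
  (eps * ((1 + eps) * (t - s) + 2 * (PI * u))) by ring.
rewrite Rabs_mult, (Rabs_pos_eq eps), Rmult_comm by lra.
apply Rmult_le_compat_r; [lra|]; apply Rabs_le.
assert (- 4 <= PI * u <= 4) by nra.
assert (- 3 <= (1 + eps) * (t - s) <= 3) by nra.
lra.
Qed.

(** The ramps contribute 24 and the oscillation 64, using [PI <= 4]. *)
Lemma wave'_lip y z : Rabs (wave' y - wave' z) <= 88 * eps * Rabs (y - z).
Proof.
unfold wave'.
set (a := - (eps * (INR N + 1))).
assert (H3 := smoothstep'_lip (eps * y + 1) (eps * z + 1)).
assert (H2 := smoothstep'_lip (eps * y + a) (eps * z + a)).
assert (H1 := cos_lip (2 * PI * clip (1 / 4) (INR N + 1 / 4) y)
                      (2 * PI * clip (1 / 4) (INR N + 1 / 4) z)).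
generalize PI_4 PI_RGT_0; intros PI_le PI_gt0.
rewrite <- Rmult_minus_distr_l, Rabs_mult, (Rabs_pos_eq (2 * PI)) in H1 by lra.
replace (eps * y + 1 - (eps * z + 1)) with (eps * (y - z)) in H3 by ring.
replace (eps * y + a - (eps * z + a)) with (eps * (y - z)) in H2 by ring.
rewrite Rabs_mult, (Rabs_pos_eq eps) in H2, H3 by lra.
assert (c_lip := clip_lip (1 / 4) (INR N + 1 / 4) y z).
set (d := Rabs (y - z)) in *; assert (d_ge0 : 0 <= d) by apply Rabs_pos.
set (C := cos (2 * PI * clip _ _ y)) in *; set (C' := cos (2 * PI * clip _ _ z)) in *.
set (S := smoothstep' (eps * y + 1)) in *; set (S' := smoothstep' (eps * z + 1)) in *.
set (T := smoothstep' (eps * y + a)) in *; set (T' := smoothstep' (eps * z + a)) in *.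
replace ((1 + eps) * (eps * S - eps * T) + eps * (2 * PI * C) -
         ((1 + eps) * (eps * S' - eps * T') + eps * (2 * PI * C'))) with
  (eps * ((1 + eps) * ((S - S') - (T - T')) + 2 * (PI * (C - C')))) by ring.
rewrite Rabs_mult, (Rabs_pos_eq eps) by lra.
rewrite (Rmult_comm 88), Rmult_assoc; apply Rmult_le_compat_l; [lra|].
assert (CC : Rabs (C - C') <= 8 * d).
{ apply Rle_trans with (1 := H1).
  apply Rmult_le_compat; try apply Rabs_pos; try lra. }
apply Rabs_le_inv in CC; apply Rabs_le_inv in H2; apply Rabs_le_inv in H3.
assert (ed : eps * d <= d) by nra.
assert (- (32 * d) <= PI * (C - C') <= 32 * d) by nra.
assert (- (24 * d) <= (1 + eps) * ((S - S') - (T - T')) <= 24 * d).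
{ assert (- (12 * d) <= (S - S') - (T - T') <= 12 * d) by lra.
  nra. }
apply Rabs_le; lra.
Qed.

End Wave.

(* [l] is the left end of the support, where [wave] has argument [- / eps]. *)
Definition bump (eps delta l : R) (N : nat) (x : R) : R :=
  delta * wave eps N (/ delta * x + - (l / delta + / eps)).

Definition bump' (eps delta l : R) (N : nat) (x : R) : R :=
  wave' eps N (/ delta * x + - (l / delta + / eps)).

Section Bump.

Variables (alpha eps delta l : R) (N : nat).
Hypothesis alpha_gt0 : 0 < alpha.
Hypothesis alpha_lt1 : alpha < 1.
Hypothesis delta_gt0 : 0 < delta.
Hypothesis delta_le1 : delta <= 1.
Hypothesis eps_eq : eps = Rpower delta alpha / 32.

Local Lemma eps_bounds : 0 < eps /\ eps <= 1 / 32.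
Proof.
generalize (Rpower_gt0 delta alpha) (Rpower_le_1 delta alpha ltac:(lra) ltac:(lra)).
rewrite eps_eq; lra.
Qed.

Lemma derivable_bump x : derivable_pt_lim (bump eps delta l N) x (bump' eps delta l N x).
Proof.
replace (bump' eps delta l N x) with (delta * (/ delta * bump' eps delta l N x))
  by (field; lra).
unfold bump, bump'.
apply (derivable_pt_lim_scal (fun x => wave _ _ (/ delta * x + _))).
apply derivable_comp_affine, derivable_wave.
Qed.

(** In the rescaled distance [t = d / delta] one has [d^alpha = 32 eps t^alpha], so the allowed
    variation is [96 eps t^alpha]. The Lipschitz bound [88 eps t] suffices for [t <= 1] and twice
    the supremum, [22 eps], for [t > 1]. The constant is therefore independent of [delta], as gluing
    requires. *)
Lemma bump_holder : holder_deriv alpha 3 (bump eps delta l N) (bump' eps delta l N).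
Proof.
destruct eps_bounds as [eps_gt0 eps_le].
split; [apply derivable_bump|]; intros x y neq; unfold bump'.
set (b := - (l / delta + / eps)).
assert (sup := wave'_bound eps N eps_gt0 eps_le).
generalize (sup (/ delta * x + b)) (sup (/ delta * y + b)).
generalize (wave'_lip eps N eps_gt0 eps_le (/ delta * x + b) (/ delta * y + b)).
replace (/ delta * x + b - (/ delta * y + b)) with (/ delta * (x - y)) by ring.
assert (inv_gt0 := Rinv_0_lt_compat _ delta_gt0).
rewrite Rabs_mult, (Rabs_pos_eq (/ delta)) by lra.
set (u := wave' _ _ _); set (v := wave' _ _ _); set (d := Rabs (x - y)).
assert (d_gt0 : 0 < d) by (apply Rabs_pos_lt; lra).
intros H1 H2 H3; apply Rabs_le_inv in H2; apply Rabs_le_inv in H3.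
assert (dd_gt0 : 0 < / delta * d) by now apply Rmult_lt_0_compat.
assert (E : Rpower d alpha = 32 * eps * Rpower (/ delta * d) alpha).
{ rewrite eps_eq; replace (32 * (Rpower delta alpha / 32)) with (Rpower delta alpha) by field.
  rewrite Rpower_mult_distr by assumption; f_equal; field; lra. }
rewrite E; destruct (Rle_lt_dec (/ delta * d) 1) as [le1 | gt1].
- apply Rle_trans with (1 := H1).
  generalize (Rpower_le_anti (/ delta * d) alpha 1); rewrite Rpower_1 by lra; nra.
- generalize (Rle_Rpower (/ delta * d) 0 alpha); rewrite Rpower_O by lra; intros H4.
  apply Rabs_le; nra.
Qed.

Lemma bump'_bound x : Rabs (bump' eps delta l N x) <= 1 / 2.
Proof.
destruct eps_bounds as [eps_gt0 eps_le].
apply Rle_trans with (11 * eps); [now apply wave'_bound | lra].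
Qed.

Lemma bump_ge0 x : 0 <= bump eps delta l N x.
Proof.
destruct eps_bounds as [eps_gt0 eps_le].
apply Rmult_le_pos; [lra | now apply wave_ge0].
Qed.

Lemma bump_outside x :
  x <= l \/ l + 64 * Rpower delta (1 - alpha) + delta * (INR N + 1) <= x ->
  bump eps delta l N x = 0 /\ bump' eps delta l N x = 0.
Proof.
destruct eps_bounds as [eps_gt0 eps_le]; intros Hx; unfold bump, bump'.
destruct (wave_outside eps N eps_gt0 eps_le (/ delta * x + - (l / delta + / eps)))
  as [-> ->]; [|split; ring].
(* The length of one ramp; the two ramps account for the coefficient 64. *)
assert (E : Rpower delta (1 - alpha) * 32 = delta * / eps).
{ replace (1 - alpha) with (1 + - alpha) by ring.
  rewrite Rpower_plus, Rpower_1, Rpower_Ropp, eps_eq by exact delta_gt0.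
  field; generalize (Rpower_gt0 delta alpha); lra. }
destruct Hx as [Hx | Hx]; [left | right]; apply Rmult_le_reg_l with delta;
  try exact delta_gt0.
- replace (delta * (/ delta * x + - (l / delta + / eps))) with (x - l - delta * / eps)
    by (field; lra); lra.
- replace (delta * (/ delta * x + - (l / delta + / eps))) with (x - l - delta * / eps)
    by (field; lra); lra.
Qed.

(** The point is [k] in the coordinate of the wave, and the height [delta] is the distance to the
    next such point, so these points form an orbit of the identity plus the bump. *)
Lemma bump_integer k : (1 <= k <= N)%nat ->
  let x := l + delta * (INR k + / eps) in
  bump eps delta l N x = delta /\ bump' eps delta l N x = eps * (2 * PI).
Proof.
destruct eps_bounds as [eps_gt0 eps_le]; intros Hk x; unfold bump, bump', x.
replace (/ delta * (l + delta * (INR k + / eps)) + - (l / delta + / eps)) with (INR k)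
  by (field; lra).
destruct (wave_integer eps N eps_gt0 k Hk) as [-> ->]; split; ring.
Qed.

End Bump.

(** * Gluing functions with disjoint supports *)

Lemma derivable_of_holder_error alpha K f x l : 0 < alpha -> 0 <= K ->
  (forall y, y <> x ->
     Rabs (f y - f x - l * (y - x)) <= K * Rpower (Rabs (y - x)) alpha * Rabs (y - x)) ->
  derivable_pt_lim f x l.
Proof.
intros a_gt0 K_ge0 H e e_gt0.
(* For [|h|] below this radius, [K |h|^alpha] is at most [K e / (K + 1) < e]. *)
exists (mkposreal _ (Rpower_gt0 (e / (K + 1)) (/ alpha))); simpl; intros h h_neq0 Hh.
specialize (H (x + h) ltac:(lra)); replace (x + h - x) with h in H by ring.
assert (h_gt0 := Rabs_pos_lt h h_neq0).
replace ((f (x + h) - f x) / h - l) with ((f (x + h) - f x - l * h) * / h)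
  by (field; exact h_neq0).
rewrite Rabs_mult, Rabs_inv.
apply Rmult_lt_reg_r with (Rabs h); [exact h_gt0|].
rewrite Rmult_assoc, Rinv_l, Rmult_1_r by lra.
apply Rle_lt_trans with (1 := H); apply Rmult_lt_compat_r; [exact h_gt0|].
apply Rle_lt_trans with (K * (e / (K + 1))).
- apply Rmult_le_compat_l; [exact K_ge0|].
  replace (e / (K + 1)) with (Rpower (Rpower (e / (K + 1)) (/ alpha)) alpha).
  + apply Rle_Rpower_l; lra.
  + rewrite Rpower_mult, Rinv_l, Rpower_1 by (try apply Rdiv_lt_0_compat; lra).
    reflexivity.
- apply Rmult_lt_reg_r with (K + 1); [lra|].
  replace (K * (e / (K + 1)) * (K + 1)) with (K * e) by (field; lra); lra.
Qed.

Lemma holder_error alpha c f g x y : 0 <= alpha -> 0 <= c -> holder_deriv alpha c f g ->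
  y <> x ->
  Rabs (f y - f x - g x * (y - x)) <= c * Rpower (Rabs (y - x)) alpha * Rabs (y - x).
Proof.
intros a_ge0 c_ge0 fg neq.
destruct (MVT_dist f g x y (proj1 fg)) as [z [E [zx _]]].
rewrite E, <- Rmult_minus_distr_r, Rabs_mult.
apply Rmult_le_compat_r; [apply Rabs_pos|].
apply (holder_le alpha c f g); auto; apply Rabs_pos_lt; lra.
Qed.

(** When [x] and [y] have different indices, the function of each vanishes with its derivative at
    the other point. The estimates for these two functions add up, whence the factor 2, however many
    functions are glued. *)
Lemma holder_glue alpha c (f g : nat -> R -> R) (idx : R -> nat) : 0 < alpha -> 0 <= c ->
  (forall i, holder_deriv alpha c (f i) (g i)) ->
  (forall x i, i <> idx x -> f i x = 0 /\ g i x = 0) ->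
  holder_deriv alpha (2 * c) (fun x => f (idx x) x) (fun x => g (idx x) x).
Proof.
intros a_gt0 c_ge0 fg supp; split.
- intros x; apply (derivable_of_holder_error alpha (2 * c)); [exact a_gt0 | lra |].
  intros y neq.
  assert (err := fun i => holder_error alpha c (f i) (g i) x y
                            (Rlt_le _ _ a_gt0) c_ge0 (fg i) neq).
  set (d := Rpower (Rabs (y - x)) alpha * Rabs (y - x)).
  assert (d_ge0 : 0 <= d) by (apply Rmult_le_pos; [left; apply Rpower_gt0 | apply Rabs_pos]).
  destruct (Nat.eq_dec (idx y) (idx x)) as [-> | ij].
  + apply Rle_trans with (1 := err (idx x)); rewrite !Rmult_assoc; fold d; nra.
  + generalize (err (idx x)) (err (idx y)).
    destruct (supp x (idx y) ij) as [-> ->].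
    destruct (supp y (idx x) (not_eq_sym ij)) as [-> _].
    rewrite !Rmult_assoc; fold d; intros H1 H2.
    apply Rabs_le_inv in H1; apply Rabs_le_inv in H2; apply Rabs_le; lra.
- intros x y neq.
  assert (Hg := fun i => proj2 (fg i) x y neq).
  set (d := Rpower (Rabs (x - y)) alpha) in *.
  assert (d_gt0 : 0 < d) by apply Rpower_gt0.
  destruct (Nat.eq_dec (idx y) (idx x)) as [-> | ij].
  + apply Rle_trans with (1 := Hg (idx x)); nra.
  + generalize (Hg (idx x)) (Hg (idx y)).
    destruct (supp x (idx y) ij) as [_ ->].
    destruct (supp y (idx x) (not_eq_sym ij)) as [_ ->]; intros H1 H2.
    apply Rabs_le_inv in H1; apply Rabs_le_inv in H2; apply Rabs_le; lra.
Qed.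

Lemma deriv_zero_at_min f x l : derivable_pt_lim f x l -> (forall y, f x <= f y) -> l = 0.
Proof.
intros fxl x_min.
rewrite <- (deriv_minimum f (x - 1) (x + 1) x (exist _ l fxl)); [reflexivity | lra | lra |].
intros; apply x_min.
Qed.

(** * Diffeomorphisms of the line restrict to diffeomorphisms of [0,1] *)

(** The substitution [u = h z] in a punctured limit: injectivity keeps the puncture, the Lipschitz
    bound gives convergence. *)
Lemma limit_comp_inj h k y l : (forall z, unit_itv z -> unit_itv (h z)) ->
  (forall z, unit_itv z -> z <> y -> h z <> h y) ->
  (forall z, unit_itv z -> Rabs (h z - h y) <= 2 * Rabs (z - y)) ->
  limit1_in k (D_x unit_itv (h y)) l (h y) ->
  limit1_in (fun z => k (h z)) (D_x unit_itv y) l y.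
Proof.
intros h_unit h_inj h_lip Hk e e_gt0; destruct (Hk e e_gt0) as [d [d_gt0 Hd]].
exists (d / 2); split; [lra|]; intros z [[z01 yz] Hz]; apply Hd; simpl in *; unfold Rdist in *.
split; [split; [now apply h_unit | apply not_eq_sym, h_inj; auto]|].
generalize (h_lip z z01); lra.
Qed.

Lemma continue_in_ext h k x : unit_itv x -> (forall y, unit_itv y -> h y = k y) ->
  continue_in h unit_itv x -> continue_in k unit_itv x.
Proof.
intros x01 hk Hh e e_gt0; destruct (Hh e e_gt0) as [d [d_gt0 Hd]].
exists d; split; [exact d_gt0|]; intros y Hy.
rewrite <- !hk by (try exact x01; apply Hy); now apply Hd.
Qed.

Lemma C1_itv_intro f g : (forall x, unit_itv x -> is_deriv f x (g x)) ->
  (forall x, unit_itv x -> continue_in g unit_itv x) -> C1_itv f.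
Proof.
intros fg g_cont.
assert (E : forall x, unit_itv x -> deriv f x = g x) by (intros; apply deriv_eq; auto).
intros x x01; split.
- change (is_deriv f x (deriv f x)); rewrite E; auto.
- apply (continue_in_ext g); auto; intros; symmetry; auto.
Qed.

(** The lower bound on [G] gives [|x - y| <= 2 |F x - F y|], hence injectivity and a 2-Lipschitz
    inverse. Difference quotients of the inverse are reciprocals of those of [F], so its derivative
    is [/ G] at the preimage. *)
Lemma Diff1_of_line F G : (forall x, derivable_pt_lim F x (G x)) -> continuity G ->
  (forall x, 1 / 2 <= G x) -> F 0 = 0 -> F 1 = 1 -> Diff1 F.
Proof.
intros FG G_cont G_ge F0 F1.
assert (expand : forall x y, Rabs (x - y) <= 2 * Rabs (F x - F y)).
{ intros x y; destruct (MVT_dist F G y x FG) as [z [-> _]].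
  rewrite Rabs_mult, (Rabs_pos_eq (G z)) by (generalize (G_ge z); lra).
  generalize (G_ge z) (Rabs_pos (x - y)); nra. }
assert (incr : forall x y, x <= y -> F x <= F y).
{ intros x y [lt | ->]; [|lra].
  destruct (MVT_cor2 F G x y lt) as [z [E _]]; [intros; apply FG|].
  generalize (G_ge z); nra. }
assert (inj : forall x y, F x = F y -> x = y).
{ intros x y E; generalize (expand x y); rewrite E, Rminus_diag, Rabs_R0.
  generalize (Rabs_pos (x - y)); intros.
  destruct (Req_dec x y) as [|neq]; [assumption|].
  generalize (Rabs_pos_lt (x - y)); lra. }
assert (F_cont : continuity F)
  by (intros x; apply derivable_continuous_pt; exists (G x); apply FG).
assert (bij : bij_itv F).
{ split; [|split; [intros; now apply inj|]].
  - intros x [x0 x1]; unfold unit_itv; generalize (incr _ _ x0) (incr _ _ x1); lra.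
  - intros y [y0 y1].
    destruct (IVT_cor (fun x => F x - y) 0 1) as [x [x01 E]].
    + apply (continuity_minus F); [exact F_cont | now apply continuity_const; intros ? ?].
    + lra.
    + cbv beta; rewrite F0, F1; nra.
    + exists x; split; [exact x01 | lra]. }
assert (h_unit : forall y, unit_itv y -> unit_itv (inv_itv F y))
  by (intros; now apply inv_itv_spec).
assert (Fh : forall y, unit_itv y -> F (inv_itv F y) = y)
  by (intros; now apply inv_itv_spec).
assert (h_inj : forall y, unit_itv y -> forall z, unit_itv z -> z <> y ->
          inv_itv F z <> inv_itv F y).
{ intros y y01 z z01 neq E; apply neq; rewrite <- (Fh y), <- (Fh z), E; auto. }
assert (h_lip : forall y, unit_itv y -> forall z, unit_itv z ->
          Rabs (inv_itv F z - inv_itv F y) <= 2 * Rabs (z - y)).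
{ intros y y01 z z01; generalize (expand (inv_itv F z) (inv_itv F y)).
  now rewrite !Fh. }
assert (G_neq0 : forall x, G x <> 0) by (intros x; generalize (G_ge x); lra).
split; [exact bij|]; split; [|split; [|now split]].
- apply (C1_itv_intro F G).
  + intros x _; apply is_deriv_global, FG.
  + intros x _; apply continuity_pt_continue_in, G_cont.
- apply (C1_itv_intro _ (fun y => / G (inv_itv F y))).
  + intros y y01 e e_gt0.
    destruct (limit_comp_inj (inv_itv F)
      (fun u => / ((F u - F (inv_itv F y)) / (u - inv_itv F y))) y (/ G (inv_itv F y))
      h_unit (h_inj y y01) (h_lip y y01)) with (eps := e) as [d [d_gt0 Hd]].
    * apply limit_inv; [|apply G_neq0].
      apply (is_deriv_global F), FG.
    * exact e_gt0.
    * exists d; split; [exact d_gt0|]; intros z [[z01 yz] Hz].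
      specialize (Hd z (conj (conj z01 yz) Hz)); simpl in *.
      rewrite !Fh in Hd by assumption.
      replace ((inv_itv F z - inv_itv F y) / (z - y)) with
        (/ ((z - y) / (inv_itv F z - inv_itv F y))); [exact Hd|].
      generalize (h_inj y y01 z z01 (not_eq_sym yz)); intros; field; lra.
  + intros y y01.
    apply (limit_comp_inj (inv_itv F) (fun u => / G u)); auto.
    apply (continuity_pt_continue_in (fun u => / G u)).
    apply (continuity_pt_inv G); [apply G_cont | apply G_neq0].
Qed.

(** * The example *)

Lemma Rpower2_succ s : Rpower 2 (s + 1) = 2 * Rpower 2 s.
Proof. rewrite Rpower_plus, Rpower_1 by lra; ring. Qed.

Lemma Rpower2_le s t : s <= t -> Rpower 2 s <= Rpower 2 t.
Proof. apply Rle_Rpower; lra. Qed.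

Lemma INR_pow2 n : INR (2 ^ n) = Rpower 2 (INR n).
Proof. rewrite pow_INR, Rpower_pow by lra; reflexivity. Qed.

Section Example.

Variables (alpha : R) (q0 : nat).
Hypothesis alpha_gt0 : 0 < alpha.
Hypothesis alpha_lt1 : alpha < 1.
Hypothesis q0_large : 8 <= (1 - alpha) * (INR q0 + 2).

(* The [j]-th bump lives on [2^-(q+1), 2^-q] with [q = q0 + j]; an orbit makes
   [2^(q^2)] steps of length [2^-(q+2)^2] on its plateau. *)
Let level (j : nat) : R := INR (q0 + j).
Let right_end (j : nat) : R := Rpower 2 (- level j).
Let left_end (j : nat) : R := Rpower 2 (- level j - 1).
Let delta (j : nat) : R := Rpower 2 (- ((level j + 2) * (level j + 2))).
Let eps (j : nat) : R := Rpower (delta j) alpha / 32.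
Let steps (j : nat) : nat := (2 ^ ((q0 + j) * (q0 + j)))%nat.

Local Lemma level_ge j : INR q0 <= level j /\ 0 <= level j.
Proof. unfold level; split; [apply le_INR; lia | apply pos_INR]. Qed.

Local Lemma right_left j : right_end j = 2 * left_end j.
Proof.
unfold right_end, left_end; rewrite <- Rpower2_succ; f_equal; ring.
Qed.

Local Lemma delta_le1 j : delta j <= 1.
Proof.
rewrite <- (Rpower_O 2) by lra; apply Rpower2_le; generalize (level_ge j); nra.
Qed.

(** The interval has length [left_end j = 4 a]: the two ramps use at most [2 a], the [steps j] steps
    at most [a], and one extra step at most [a]. The ramps are what force [q0] to be large:
    [q0_large] yields [delta^(1 - alpha) <= 2^(-8 (q + 2))]. *)
Local Lemma bump_fits j :
  left_end j + 64 * Rpower (delta j) (1 - alpha) + delta j * (INR (steps j) + 1)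
  <= right_end j.
Proof.
rewrite right_left.
destruct (level_ge j) as [q0_le q_ge0].
set (a := Rpower 2 (- level j - 3)).
assert (E1 : left_end j = 2 * (2 * a)).
{ unfold a, left_end; rewrite <- !Rpower2_succ; f_equal; ring. }
assert (H1 : 64 * Rpower (delta j) (1 - alpha) <= 2 * a).
{ replace 64 with (Rpower 2 (INR 6)) by (rewrite Rpower_pow by lra; simpl; ring).
  unfold delta, a; rewrite Rpower_mult, <- Rpower_plus, <- Rpower2_succ.
  apply Rpower2_le; simpl INR.
  assert (8 <= (1 - alpha) * (level j + 2)) by nra.
  assert (8 * (level j + 2) <= (1 - alpha) * (level j + 2) * (level j + 2)) by nra.
  lra. }
assert (H2 : delta j * INR (steps j) <= a).
{ unfold steps, delta, a; rewrite INR_pow2, <- Rpower_plus, mult_INR; fold (level j).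
  apply Rpower2_le; lra. }
assert (H3 : delta j <= a) by (apply Rpower2_le; nra).
lra.
Qed.

Definition bump_at (j : nat) : R -> R := bump (eps j) (delta j) (left_end j) (steps j).

Definition bump_at' (j : nat) : R -> R := bump' (eps j) (delta j) (left_end j) (steps j).

Local Lemma bump_at_supp j x : ~ (left_end j < x < right_end j) ->
  bump_at j x = 0 /\ bump_at' j x = 0.
Proof.
intros Hx; apply (bump_outside alpha); auto; try apply Rpower_gt0; [apply delta_le1|].
generalize (bump_fits j); lra.
Qed.

Local Lemma supports_disjoint i j x : left_end i < x < right_end i ->
  left_end j < x < right_end j -> i = j.
Proof.
assert (aux : forall i j, left_end i < x < right_end i ->
          left_end j < x < right_end j -> ~ (i < j)%nat).
{ intros k l Hk Hl kl.
  assert (right_end l <= left_end k); [|lra].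
  apply Rpower2_le; unfold level.
  assert (INR (q0 + k) + 1 <= INR (q0 + l)) by (rewrite <- S_INR; apply le_INR; lia).
  lra. }
intros Hi Hj; generalize (aux i j Hi Hj) (aux j i Hj Hi); lia.
Qed.

(* An arbitrary index if no bump contains [x] in its support. *)
Definition bump_index (x : R) : nat :=
  epsilon (inhabits O) (fun j => left_end j < x < right_end j).

Local Lemma bump_index_supp x i : i <> bump_index x ->
  bump_at i x = 0 /\ bump_at' i x = 0.
Proof.
intros neq; apply bump_at_supp; intros Hi; apply neq.
apply (supports_disjoint _ _ x Hi).
apply (epsilon_spec (inhabits O) (fun j => left_end j < x < right_end j)); now exists i.
Qed.

Definition example (x : R) : R := x + bump_at (bump_index x) x.

Definition example' (x : R) : R := 1 + bump_at' (bump_index x) x.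

Local Lemma glued : holder_deriv alpha (2 * 3)
  (fun x => bump_at (bump_index x) x) (fun x => bump_at' (bump_index x) x).
Proof.
apply holder_glue; [exact alpha_gt0 | lra | | exact bump_index_supp].
intros j; apply bump_holder; auto; [apply Rpower_gt0 | apply delta_le1].
Qed.

Local Lemma derivable_example x : derivable_pt_lim example x (example' x).
Proof.
apply (derivable_pt_lim_plus id); [apply derivable_pt_lim_id | apply glued].
Qed.

Local Lemma deriv_example x : unit_itv x -> deriv example x = example' x.
Proof. intros x01; apply deriv_eq; [exact x01 | apply is_deriv_global, derivable_example]. Qed.

Local Lemma example_unit_end x : x = 0 \/ x = 1 -> example x = x.
Proof.
intros Hx; unfold example; set (j := bump_index x).
destruct (bump_at_supp j x) as [-> _]; [|ring].
destruct Hx as [-> | ->].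
- generalize (Rpower_gt0 2 (- level j - 1)); unfold left_end; lra.
- enough (right_end j <= 1) by lra.
  rewrite <- (Rpower_O 2) by lra; apply Rpower2_le; generalize (level_ge j); lra.
Qed.

Lemma example_Diff1_Lip : Diff1_Lip alpha example.
Proof.
split.
- apply (Diff1_of_line example example').
  + apply derivable_example.
  + apply (continuity_plus (fun _ => 1)); [now apply continuity_const; intros ? ?|].
    apply (holder_deriv_continuity _ _ _ _ alpha_gt0) with (2 := glued); lra.
  + intros x; unfold example'; set (j := bump_index x).
    assert (H : Rabs (bump_at' j x) <= 1 / 2).
    { apply (bump'_bound alpha); auto; [apply Rpower_gt0 | apply delta_le1]. }
    apply Rabs_le_inv in H; lra.
  + now apply example_unit_end; left.
  + now apply example_unit_end; right.
- exists (2 * 3); intros x y x01 y01 neq; rewrite !deriv_example by assumption.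
  unfold example'.
  replace (1 + bump_at' (bump_index x) x - (1 + bump_at' (bump_index y) y)) with
    (bump_at' (bump_index x) x - bump_at' (bump_index y) y) by ring.
  now apply glued.
Qed.

(** At a fixed point the glued bump vanishes; being nonnegative everywhere, it has a minimum there
    and so a zero derivative. *)
Lemma example_E1_empty x : ~ E1_itv example x.
Proof.
intros [x01 [fx neq]]; apply neq; rewrite deriv_example by exact x01.
unfold example', example in *.
rewrite (deriv_zero_at_min _ _ _ (proj1 glued x)); [ring|].
intros y; cbv beta; replace (bump_at (bump_index x) x) with 0 by lra.
apply (bump_ge0 alpha); auto; [apply Rpower_gt0 | apply delta_le1].
Qed.

Local Lemma example_plateau j k : (1 <= k <= steps j)%nat ->
  let x := left_end j + delta j * (INR k + / eps j) in
  unit_itv x /\ example x = x + delta j /\ example' x = 1 + eps j * (2 * PI).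
Proof.
intros Hk x.
destruct (bump_integer alpha (eps j) (delta j) (left_end j) (steps j)) with (k := k)
  as [H1 H2]; auto; try apply Rpower_gt0; [apply delta_le1|].
fold x (bump_at j x) in H1; fold x (bump_at' j x) in H2.
assert (delta_gt0 : 0 < delta j) by apply Rpower_gt0.
(* The bump of index [j] is nonzero at [x], which identifies the index and also places [x] in the
   support. *)
assert (E : bump_index x = j).
{ destruct (Nat.eq_dec j (bump_index x)) as [|neq]; [now symmetry|].
  destruct (bump_index_supp x j neq) as [H _]; rewrite H in H1; lra. }
split; [|unfold example, example'; rewrite E, H1, H2; now split].
assert (x_in : left_end j < x < right_end j).
{ apply NNPP; intros Hx; destruct (bump_at_supp j x Hx) as [H _]; rewrite H in H1; lra. }
assert (left_gt0 : 0 < left_end j) by apply Rpower_gt0.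
assert (right_le1 : right_end j <= 1).
{ rewrite <- (Rpower_O 2) by lra; apply Rpower2_le; generalize (level_ge j); lra. }
unfold unit_itv; lra.
Qed.

Lemma example_growth j n : (n <= steps j)%nat ->
  INR n * Rpower (delta j) alpha / 16 <= ln (Gamma example n).
Proof.
intros n_le.
assert (steps_ge1 : (1 <= steps j)%nat)
  by (unfold steps; assert (H := Nat.pow_nonzero 2 ((q0 + j) * (q0 + j))); lia).
set (x := left_end j + delta j * (INR 1 + / eps j)).
set (p := 1 + eps j * (2 * PI)).
(* The orbit starts at the plateau point of index 1, so time [k] corresponds to index [k + 1]. The
   position is claimed only for [k < n], where this index is at most [steps j]; the product at time
   [n] uses no later point. *)
assert (orbit : forall k, (k <= n)%nat ->
  orbit_prod (deriv example) example k x = p ^ k /\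
  ((k < n)%nat -> Nat.iter k example x = left_end j + delta j * (INR (S k) + / eps j))).
{ induction k as [|k IHk]; intros k_le; [now split|].
  destruct (IHk ltac:(lia)) as [IH1 IH2]; specialize (IH2 k_le).
  destruct (example_plateau j (S k)) as [y01 [fy gy]]; [lia|].
  simpl orbit_prod; simpl Nat.iter; rewrite IH1, IH2, fy, deriv_example, gy by exact y01.
  split; [simpl; fold p; ring|]; intros _; rewrite (S_INR (S k)); ring. }
destruct (example_plateau j 1) as [x01 _]; [lia|]; fold x in x01.
assert (delta_alpha := Rpower_gt0 (delta j) alpha).
assert (delta_alpha_le1 : Rpower (delta j) alpha <= 1).
{ apply Rpower_le_1; [split; [apply Rpower_gt0 | apply delta_le1] | lra]. }
assert (PI_gt2 : 2 < PI) by (generalize PI2_1; lra).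
assert (p_bounds : 1 + 4 * eps j <= p <= 2).
{ unfold p; generalize PI_4; unfold eps; split; nra. }
assert (eps_gt0 : 0 < eps j) by (unfold eps; lra).
apply Rle_trans with (ln (p ^ n)).
- rewrite <- Rpower_pow, ln_Rpower by lra.
  replace (INR n * Rpower (delta j) alpha / 16) with (INR n * (2 * eps j))
    by (unfold eps; field).
  apply Rmult_le_compat_l; [apply pos_INR|].
  (* [ln p >= 1 - / p >= 2 eps], the second inequality from [1 + 4 eps <= p <= 2]. *)
  assert (H := ln_le_sub1 (/ p) (Rinv_0_lt_compat p ltac:(lra))).
  rewrite ln_Rinv in H by lra.
  enough (/ p <= 1 - 2 * eps j) by lra.
  apply Rmult_le_reg_l with p; [lra|]; rewrite Rinv_r by lra; nra.
- apply ln_le; [apply pow_lt; lra|].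
  destruct (Gamma_bounds example n (proj1 example_Diff1_Lip)) as [H _].
  specialize (H x x01); rewrite (proj1 (orbit n (le_n n))) in H.
  rewrite Rabs_pos_eq in H; [exact H | apply pow_le; lra].
Qed.

End Example.

(** * From the bumps to the growth exponent *)

Lemma growth_example alpha : 0 < alpha < 1 ->
  exists f, Diff1_Lip alpha f /\ (forall x, ~ E1_itv f x) /\
    exists q0, forall q n, (q0 <= q)%nat -> (n <= 2 ^ (q * q))%nat ->
      INR n * Rpower 2 (- (alpha * ((INR q + 2) * (INR q + 2)))) / 16 <= ln (Gamma f n).
Proof.
intros [a_gt0 a_lt1].
destruct (INR_unbounded (8 / (1 - alpha))) as [q0 Hq0].
assert (q0_large : 8 <= (1 - alpha) * (INR q0 + 2)).
{ assert (E : (1 - alpha) * (8 / (1 - alpha)) = 8) by (field; lra); nra. }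
exists (example alpha q0); split; [|split].
- now apply example_Diff1_Lip.
- now apply example_E1_empty.
- exists q0; intros q n q_ge n_le.
  generalize (example_growth alpha q0 a_gt0 a_lt1 q0_large (q - q0) n).
  replace (q0 + (q - q0))%nat with q by lia.
  rewrite Rpower_mult; intros H.
  replace (- (alpha * ((INR q + 2) * (INR q + 2)))) with
    (- ((INR q + 2) * (INR q + 2)) * alpha) by ring.
  now apply H.
Qed.

Theorem theorem4 (alpha : R) (alpha_gt0 : 0 < alpha) (alpha_lt1 : alpha < 1) :
  (forall f : R -> R,
     Diff1_Lip alpha f -> (forall x, ~ E1_itv f x) ->
     exists (C : R) (N : nat), forall n : nat, (N <= n)%nat ->
       Rabs (ln (Gamma f n)) <= C * Rpower (INR n) (1 - alpha))
  /\
  (exists f : R -> R,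
     Diff1_Lip alpha f /\ (forall x, ~ E1_itv f x) /\
     Un_cv (fun n : nat => ln (ln (Gamma f n)) / ln (INR n)) (1 - alpha)).
Proof.
split.
{ intros f Hf noE1.
  destruct (growth_upper_bound alpha f (conj alpha_gt0 alpha_lt1) Hf noE1) as [C [_ HC]].
  now exists C, 1%nat. }
destruct (growth_example alpha (conj alpha_gt0 alpha_lt1)) as [f [Hf [noE1 [q0 low]]]].
exists f; split; [exact Hf|]; split; [exact noE1|].
destruct (growth_upper_bound alpha f (conj alpha_gt0 alpha_lt1) Hf noE1) as [C [C_gt0 HC]].
(* The loss from [(1 - alpha) ln n] is of order [sqrt (ln n)]; for every [e] it is at most [e ln n]
   plus constants. *)
assert (lower : exists B, forall e, 0 < e -> exists D, forall n, (2 ^ (q0 * q0) <= n)%nat ->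
  0 < ln (Gamma f n) /\ (1 - alpha) * ln (INR n) - e * ln (INR n) - D - B <= ln (ln (Gamma f n))).
{ assert (ln2_gt0 : 0 < ln 2) by (rewrite <- ln_1; apply ln_increasing; lra).
  exists (9 * alpha * ln 2 + ln 16); intros e e_gt0.
  exists (9 * alpha * alpha * ln 2 / e); intros n n_ge.
  assert (n_ge1 : (1 <= n)%nat)
    by (assert (H := Nat.pow_nonzero 2 (q0 * q0)); lia).
  assert (n_gt0 : 0 < INR n) by (apply lt_0_INR; lia).
  (* The bump of level [q = r + 1] is used: [n <= 2^(q^2)] lets the orbit stay on its plateau up to
     time [n], while [2^(r^2) <= n] keeps [delta] from being too small. *)
  set (r := Nat.sqrt (Nat.log2 n)).
  destruct (Nat.sqrt_specif (Nat.log2 n)) as [r_lo r_hi]; fold r in r_lo, r_hi.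
  destruct (Nat.log2_spec n n_ge1) as [l_lo l_hi].
  assert (q0_le : (q0 <= S r)%nat).
  { assert (H : (q0 * q0 <= Nat.log2 n)%nat) by (apply Nat.log2_le_pow2; lia); nia. }
  assert (n_le : (n <= 2 ^ (S r * S r))%nat).
  { apply Nat.le_trans with (2 ^ S (Nat.log2 n))%nat; [lia | apply Nat.pow_le_mono_r; lia]. }
  assert (rr : INR r * INR r * ln 2 <= ln (INR n)).
  { rewrite <- mult_INR, <- ln_Rpower, <- INR_pow2; apply ln_le.
    - apply lt_0_INR; assert (H := Nat.pow_nonzero 2 (r * r)); lia.
    - apply le_INR, Nat.le_trans with (2 := l_lo), Nat.pow_le_mono_r; lia. }
  specialize (low (S r) n q0_le n_le); rewrite S_INR in low.
  set (t := INR r + 1 + 2) in low.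
  assert (low_gt0 : 0 < INR n * Rpower 2 (- (alpha * (t * t))) / 16).
  { apply Rdiv_lt_0_compat; [|lra]; apply Rmult_lt_0_compat; [exact n_gt0 | apply Rpower_gt0]. }
  split; [lra|].
  apply ln_le in low; [|exact low_gt0].
  rewrite ln_div, ln_mult, ln_Rpower in low
    by (try apply Rmult_lt_0_compat; try apply Rpower_gt0; lra).
  (* AM-GM absorbs the linear term of [t^2 = (r + 3)^2]. *)
  assert (amgm : 6 * alpha * INR r <= e * (INR r * INR r) + 9 * alpha * alpha / e).
  { apply Rmult_le_reg_l with e; [exact e_gt0|].
    replace (e * (e * (INR r * INR r) + 9 * alpha * alpha / e)) with
      (e * INR r * (e * INR r) + 9 * (alpha * alpha)) by (field; lra).
    generalize (Rle_0_sqr (e * INR r - 3 * alpha)); unfold Rsqr; lra. }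
  apply (Rmult_le_compat_r (ln 2)) in amgm; [|lra].
  replace (9 * alpha * alpha * ln 2 / e) with (9 * alpha * alpha / e * ln 2) by (field; lra).
  unfold t in low.
  assert (e * (INR r * INR r * ln 2) <= e * ln (INR n)) by (apply Rmult_le_compat_l; lra).
  assert (alpha * (INR r * INR r * ln 2) <= alpha * ln (INR n))
    by (apply Rmult_le_compat_l; lra).
  lra. }
destruct lower as [B lower].
intros e e_gt0.
destruct (lower (e / 3) ltac:(lra)) as [D HD].
(* [K] dominates the constants of both bounds. For [n >= n0], [ln n] exceeds [3 K / e], so after
   division by [ln n] they contribute less than [e / 3], leaving room for the [e / 3] loss in the
   lower bound. *)
set (K := Rabs (ln C) + Rabs (D + B)).
destruct (INR_unbounded (exp (3 * K / e + 1))) as [n0 Hn0].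
exists (Nat.max n0 (2 ^ (q0 * q0)))%nat; intros n n_ge; unfold Rdist.
destruct (HD n ltac:(lia)) as [Gamma_gt0 lo].
assert (n_gt : exp (3 * K / e + 1) < INR n).
{ apply Rlt_le_trans with (1 := Hn0), le_INR; lia. }
assert (n_gt0 : 0 < INR n) by (generalize (exp_pos (3 * K / e + 1)); lra).
set (L := ln (INR n)) in *.
assert (L_gt : 3 * K / e + 1 < L).
{ unfold L; rewrite <- (ln_exp (3 * K / e + 1)); apply ln_increasing; [apply exp_pos | exact n_gt]. }
assert (K_ge0 : 0 <= K) by (unfold K; generalize (Rabs_pos (ln C)) (Rabs_pos (D + B)); lra).
assert (K_lt : 3 * K < e * L).
{ assert (E : 3 * K = e * (3 * K / e)) by (field; lra); nra. }
assert (L_gt0 : 0 < L).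
{ apply Rmult_lt_reg_l with e; lra. }
assert (hi : ln (ln (Gamma f n)) <= ln C + (1 - alpha) * L).
{ unfold L; rewrite <- ln_Rpower, <- ln_mult by (try apply Rpower_gt0; exact C_gt0).
  apply ln_le; [exact Gamma_gt0|].
  apply Rle_trans with (1 := Rle_abs _), HC.
  destruct n; [simpl in n_gt0; lra | lia]. }
replace (ln (ln (Gamma f n)) / L - (1 - alpha)) with
  ((ln (ln (Gamma f n)) - (1 - alpha) * L) * / L) by (field; lra).
rewrite Rabs_mult, Rabs_inv, (Rabs_pos_eq L) by lra.
apply Rmult_lt_reg_r with L; [exact L_gt0|].
rewrite Rmult_assoc, Rinv_l, Rmult_1_r by lra.
assert (Rabs (ln C) <= K) by (unfold K; generalize (Rabs_pos (D + B)); lra).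
assert (Rabs (D + B) <= K) by (unfold K; generalize (Rabs_pos (ln C)); lra).
apply Rabs_def1.
- generalize (Rle_abs (ln C)); lra.
- generalize (Rle_abs (D + B)); lra.
Qed.
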